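(* Let $\mathbb{M}$ be a smooth connected manifold of dimension $n+m$ equipped with a Riemannian foliation with bundle-like metric $g$ and totally geodesic $m$-dimensional leaves, and let $\varepsilon>0$. For every $\eta\in\Gamma^\infty(T^*\mathbb{M})$, $$\frac12\Delta_{\mathcal H}\|\eta\|_\varepsilon^2-\langle\square_\varepsilon\eta,\eta\rangle_\varepsilon=\|\nabla_{\mathcal H}\eta-\mathfrak{T}^\varepsilon_{\mathcal H}\eta\|_\varepsilon^2+\langle\mathfrak{Ric}_{\mathcal H}(\eta),\eta\rangle_{\mathcal H}-\langle\delta_{\mathcal H}T(\eta),\eta\rangle_{\mathcal V}+\frac1\varepsilon\langle\mathbf{J}^2(\eta),\eta\rangle_{\mathcal H}.$$
   Context: A foliation is Riemannian with bundle-like metric $g$ if locally it is given by the fibers of Riemannian submersions. $\mathcal V$ is the sub-bundle tangent to the leaves, $\mathcal H=\mathcal V^\perp$, $g=g_{\mathcal H}\oplus g_{\mathcal V}$ and $g_\varepsilon=g_{\mathcal H}\oplus\frac1\varepsilon g_{\mathcal V}$. On one-forms, split into horizontal and vertical parts ($T^*\mathbb{M}=\mathcal H^*\oplus\mathcal V^*$), $\|\eta\|_\varepsilon^2=\|\eta\|_{\mathcal H}^2+\varepsilon\|\eta\|_{\mathcal V}^2$. Bott connection: with $D$ the Levi-Civita connection of $g$, $\nabla_XY=(D_XY)_{\mathcal H}$ for $X,Y$ horizontal, $[X,Y]_{\mathcal H}$ for $X$ vertical and $Y$ horizontal, $[X,Y]_{\mathcal V}$ for $X$ horizontal and $Y$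 vertical, $(D_XY)_{\mathcal V}$ for $X,Y$ vertical. $T$ is its torsion; $T(X,Y)=-[X,Y]_{\mathcal V}$ for horizontal $X,Y$. For a vector $Z$, $J_Z:\mathcal H\to\mathcal H$ is the skew-symmetric map with $g_{\mathcal H}(J_ZX,Y)=g_{\mathcal V}(Z,T(X,Y))$, extended by $0$ on $\mathcal V$. $\mathbf J^2=\sum_{\ell=1}^mJ_{Z_\ell}J_{Z_\ell}$ for a local orthonormal vertical frame. $\delta_{\mathcal H}T(X)=-\sum_{j=1}^n(\nabla_{X_j}T)(X_j,X)$ for a local orthonormal horizontal frame $(X_j)$. A $(1,1)$ tensor $A$ acts on one-forms as the $g$-adjoint of its dual map. $\mathfrak{Ric}_{\mathcal H}$ is the fiberwise symmetric linear map on one-forms with $\langle\mathfrak{Ric}_{\mathcal H}(df),dh\rangle=\mathbf{Ricci}(\nabla_{\mathcal H}f,\nabla_{\mathcal H}h)$, where $\mathbf{Ricci}$ is the Ricci curvature of $\nabla$ and $\nabla_{\mathcal H}f$ is the horizontal projection of the gradient. For a horizontal vector field $V$ and a one-form $\eta$: $\mathfrak T^\varepsilon_V\eta(Y)=\frac1\varepsilon\eta(J_YV)$ for $Y$ vertical and $\mathfrak T^\varepsilon_V\eta(Y)=-\eta(T(V,Y))$ for $Y$ horizontal. With $(\theta_i)$ the coframe dual to $(X_i)$: $\nabla_{\mathcal H}\eta=\sum_{i=1}^n\nabla_{X_i}\eta\otimes\theta_i$ and $\mathfrak T^\varepsilon_{\mathcal H}\eta=\sum_{i=1}^n\mathfrak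 T^\varepsilon_{X_i}\eta\otimes\theta_i$; $\|\sum_i\alpha_i\otimes\theta_i\|^2_\varepsilon=\sum_i\|\alpha_i\|_\varepsilon^2$. The horizontal Laplacian on functions satisfies $\int f\Delta_{\mathcal H}h\,d\mu=-\int\langle\nabla_{\mathcal H}f,\nabla_{\mathcal H}h\rangle d\mu$ ($\mu$ the Riemannian volume); locally $\Delta_{\mathcal H}=\sum_iX_i^2-\nabla_{X_i}X_i$. Finally $$\square_\varepsilon=-(\nabla_{\mathcal H}-\mathfrak T^\varepsilon_{\mathcal H})^*(\nabla_{\mathcal H}-\mathfrak T^\varepsilon_{\mathcal H})-\frac1\varepsilon\mathbf J^2+\frac1\varepsilon\delta_{\mathcal H}T-\mathfrak{Ric}_{\mathcal H},$$ adjoint with respect to $g_\varepsilon$ (and $\mu$); locally $-(\nabla_{\mathcal H}-\mathfrak T^\varepsilon_{\mathcal H})^*(\nabla_{\mathcal H}-\mathfrak T^\varepsilon_{\mathcal H})=\sum_{i=1}^n(\nabla_{X_i}-\mathfrak T^\varepsilon_{X_i})^2-(\nabla_{\nabla_{X_i}X_i}-\mathfrak T^\varepsilon_{\nabla_{X_i}X_i})$. *)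

(* Defs.v *)
From HB Require Import structures.
From mathcomp Require Import all_boot all_order all_algebra.
From mathcomp Require Import all_classical all_reals all_analysis.
Import Order.TTheory GRing.Theory Num.Theory.
Import numFieldNormedType.Exports.

Set Implicit Arguments.
Unset Strict Implicit.
Unset Printing Implicit Defensive.

Local Open Scope classical_set_scope.
Local Open Scope ring_scope.

Section euclidean.
Context {R : realType} {d : nat}.

Fixpoint Ck_on (k : nat) (A : set 'rV[R]_d) (f : 'rV[R]_d -> R) : Prop :=
  (forall x, A x -> {for x, continuous f}) /\
  match k with
  | 0%N => True
  | k'.+1 => forall i : 'I_d,
      (forall x, A x -> derivable f x (delta_mx 0 i)) /\
      Ck_on k' A (fun x => 'D_(delta_mx 0 i) f x)
  end.

(* Meant for open [A] only. *)
Definition smooth_on (A : set 'rV[R]_d) (f : 'rV[R]_d -> R) : Prop :=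
  forall k, Ck_on k A f.

Definition open_metric (W : set 'rV[R]_d) (b : 'rV[R]_d -> 'M[R]_d) : Prop :=
  [/\ forall y, W y -> (b y)^T = b y,
      forall y, W y -> forall w : 'rV[R]_d, w != 0 -> 0 < (w *m b y *m w^T) 0 0
    & forall i j : 'I_d, smooth_on W (fun y => b y i j)].

End euclidean.

(* An atlas containing, for each point [p], a chart [phi p] whose domain
   [dom p] contains [p]; [psi p] is the inverse of [phi p].  One chart chosen
   around each point is enough to determine a smooth structure, and the chart
   attached to [p] serves to represent the tangent space at [p], see below. *)
Record atlas (R : realType) (d : nat) (M : topologicalType) := Atlas {
  dom : M -> set M ;
  phi : M -> M -> 'rV[R]_d ;
  psi : M -> 'rV[R]_d -> M ;
  dom_open : forall p, open (dom p) ;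
  dom_mem : forall p, dom p p ;
  img_open : forall p, open (phi p @` dom p) ;
  phiK : forall p q, dom p q -> psi p (phi p q) = q ;
  phi_continuous : forall p q, dom p q -> {for q, continuous (phi p)} ;
  psi_continuous : forall p y,
    (phi p @` dom p) y -> {for y, continuous (psi p)} ;
  transition_smooth : forall p q (i : 'I_d),
    smooth_on (phi p @` (dom p `&` dom q)) (fun y => phi q (psi p y) 0 i)
}.

(* A tangent vector at [p] is given by its row of coordinates in the basis
   of coordinate vectors of the chart [phi p], and a covector at [p] by its row
   of coordinates in the dual basis. *)
Definition vfield (R : realType) (d : nat) (M : Type) := M -> 'rV[R]_d.
Definition oneform (R : realType) (d : nat) (M : Type) := M -> 'rV[R]_d.

Section calculus.
Context {R : realType} {d : nat} {M : topologicalType}.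
Variable A : atlas R d M.
Local Notation vfield := (vfield R d M).
Local Notation oneform := (oneform R d M).

Definition smooth_fun (U : set M) (f : M -> R) : Prop :=
  forall a, smooth_on (phi A a @` (U `&` dom A a)) (f \o psi A a).

Definition tder (p : M) (v : 'rV[R]_d) (f : M -> R) : R :=
  'D_v (f \o psi A p) (phi A p p).

Definition vder (X : vfield) (f : M -> R) : M -> R := fun p => tder p (X p) f.

Definition pairing (a x : 'rV[R]_d) : R := (a *m x^T) 0 0.

(* The vector field on [dom A a] with constant coordinates [x] in the chart
   [phi a].  It takes the value [x] at [a]; [cfield a (delta_mx 0 k)] is the
   k-th coordinate vector field. *)
Definition cfield (a : M) (x : 'rV[R]_d) : vfield :=
  fun q => 'D_x (phi A q \o psi A a) (phi A a q).

Definition smooth_vfield (U : set M) (X : vfield) : Prop :=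
  forall a (i : 'I_d),
    smooth_fun (U `&` dom A a) (vder X (fun q => phi A a q 0 i)).

Definition smooth_form (U : set M) (eta : oneform) : Prop :=
  forall a (k : 'I_d),
    smooth_fun (U `&` dom A a)
      (fun q => pairing (eta q) (cfield a (delta_mx 0 k) q)).

Definition lie (X Y : vfield) : vfield := fun p =>
  \row_i (vder X (vder Y (fun q => phi A p q 0 i)) p
        - vder Y (vder X (fun q => phi A p q 0 i)) p).

End calculus.

Section metric.
Context {R : realType} {d : nat} {M : topologicalType}.
Variable A : atlas R d M.
Local Notation vfield := (vfield R d M).

(* [g p] is the Gram matrix of the metric on the tangent space at [p]. *)
Variable g : M -> 'M[R]_d.

Definition gip (p : M) (x y : 'rV[R]_d) : R := (x *m g p *m y^T) 0 0.

Definition riemannian_metric : Prop :=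
  [/\ forall p, (g p)^T = g p,
      forall p (x : 'rV[R]_d), x != 0 -> 0 < gip p x x
    & forall a (i j : 'I_d), smooth_fun A (dom A a)
        (fun q => gip q (cfield A a (delta_mx 0 i) q)
                        (cfield A a (delta_mx 0 j) q))].

Definition cogip (p : M) (a b : 'rV[R]_d) : R := (a *m invmx (g p) *m b^T) 0 0.

Definition sharp (p : M) (a : 'rV[R]_d) : 'rV[R]_d := a *m invmx (g p).

(* The adjoint, for the metric on covectors at [p], of [a |-> a *m B]. *)
Definition cogadj (p : M) (B : 'M[R]_d) : 'M[R]_d := invmx (g p) *m B^T *m g p.

(* Action on covectors of the endomorphism [x |-> x *m B] of the tangent
   space at [p]: the dual map of this endomorphism is [a |-> a *m B^T]. *)
Definition tensor_act (p : M) (B : 'M[R]_d) (a : 'rV[R]_d) : 'rV[R]_d :=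
  a *m cogadj p B^T.

(* Requiring the axioms over every open set (that is, for the restriction of
   the connection to every open submanifold) makes [D] a local operator. *)
Definition levi_civita (D : vfield -> vfield -> vfield) : Prop :=
  forall U : set M, open U ->
  forall X Y : vfield, smooth_vfield A U X -> smooth_vfield A U Y ->
  [/\ smooth_vfield A U (D X Y),
      forall X' : vfield, smooth_vfield A U X' ->
        forall p, U p -> D (fun q => X q + X' q) Y p = D X Y p + D X' Y p,
      forall Y' : vfield, smooth_vfield A U Y' ->
        forall p, U p -> D X (fun q => Y q + Y' q) p = D X Y p + D X Y' p,
      forall f, smooth_fun A U f -> forall p, U p ->
        D (fun q => f q *: X q) Y p = f p *: D X Y p /\
        D X (fun q => f q *: Y q) p = vder A X f p *: Y p + f p *: D X Y p
    & (forall p, U p -> D X Y p - D Y X p = lie A X Y p) /\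
      (forall Z : vfield, smooth_vfield A U Z -> forall p, U p ->
        vder A X (fun q => gip q (Y q) (Z q)) p
        = gip p (D X Y p) (Z p) + gip p (Y p) (D X Z p))].

(* The vertical space at [p] is the row space of [V p]. *)
Variable V : M -> 'M[R]_d.

Definition hspace (p : M) : 'M[R]_d := kermx (g p *m (V p)^T).
Definition vpr (p : M) : 'M[R]_d := proj_mx (V p) (hspace p).
Definition hpr (p : M) : 'M[R]_d := proj_mx (hspace p) (V p).

(* [V] is the tangent distribution of the foliation whose leaves are locally
   the fibers of Riemannian submersions onto n-dimensional manifolds, which may
   be taken to be open subsets of R^n with a metric [b]. *)
Definition riemannian_submersion (n : nat) (U : set M)
    (f : M -> 'rV[R]_n) (b : 'rV[R]_n -> 'M[R]_n) : Prop :=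
  let df q (x : 'rV[R]_d) : 'rV[R]_n :=
    \row_i tder A q x (fun q' => f q' 0 i) in
  [/\ open (f @` U) /\ open_metric (f @` U) b,
      forall i : 'I_n, smooth_fun A U (fun q => f q 0 i),
      forall q, U q -> forall w, exists x, df q x = w,
      forall q, U q -> forall x, (x <= V q)%MS <-> df q x = 0
    & forall q, U q -> forall x y, (x <= hspace q)%MS -> (y <= hspace q)%MS ->
        gip q x y = (df q x *m b (f q) *m (df q y)^T) 0 0].

Definition riemannian_foliation (n : nat) : Prop :=
  forall p, exists (U : set M) (f : M -> 'rV[R]_n) (b : 'rV[R]_n -> 'M[R]_n),
    [/\ open U, U p & riemannian_submersion U f b].

Definition totally_geodesic_leaves (D : vfield -> vfield -> vfield) : Prop :=
  forall (U : set M) (X Y : vfield), open U ->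
    smooth_vfield A U X -> smooth_vfield A U Y ->
    (forall q, U q -> (X q <= V q)%MS) -> (forall q, U q -> (Y q <= V q)%MS) ->
    forall q, U q -> (D X Y q <= V q)%MS.

(* Local orthonormal frames of a distribution [E], on a neighborhood of [p]. *)
Definition local_onframe (E : M -> 'M[R]_d) (k : nat) (p : M)
    (X : 'I_k -> vfield) : Prop :=
  exists U : set M, [/\ open U, U p, forall i, smooth_vfield A U (X i)
    & forall q, U q -> (forall i, (X i q <= E q)%MS) /\
        (forall i j, gip q (X i q) (X j q) = (i == j)%:R)].

(* Expressions defined from a local orthonormal frame but independent of its
   choice are evaluated at [p] by means of a chosen frame near [p]. *)
Definition onframe (E : M -> 'M[R]_d) (k : nat) (p : M) : 'I_k -> vfield :=
  xget (fun _ _ => 0) [set X : 'I_k -> M -> 'rV[R]_d | local_onframe E p X].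

End metric.

Section bott.
Context {R : realType} {n m : nat} {M : topologicalType}.
Local Notation d := (n + m)%N.
Variables (A : atlas R d M) (g : M -> 'M[R]_d) (V : M -> 'M[R]_d).
Local Notation vfield := (vfield R d M).
Local Notation oneform := (oneform R d M).
Variable D : vfield -> vfield -> vfield.

Local Notation vpr := (vpr g V).
Local Notation hpr := (hpr g V).
Local Notation lie := (lie A).
Local Notation vder := (vder A).
Local Notation cfield := (cfield A).

Definition hpart (X : vfield) : vfield := fun p => X p *m hpr p.
Definition vpart (X : vfield) : vfield := fun p => X p *m vpr p.

Definition hframe (p : M) : 'I_n -> vfield := onframe A g (hspace g V) p.
Definition vframe (p : M) : 'I_m -> vfield := onframe A g V p.

Definition bott (X Y : vfield) : vfield := fun p =>
  hpart (D (hpart X) (hpart Y)) p + hpart (lie (vpart X) (hpart Y)) p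
  + vpart (lie (hpart X) (vpart Y)) p + vpart (D (vpart X) (vpart Y)) p.

Definition torsion (X Y : vfield) : vfield := fun p =>
  bott X Y p - bott Y X p - lie X Y p.

Definition curvature (X Y Z : vfield) : vfield := fun p =>
  bott X (bott Y Z) p - bott Y (bott X Z) p - bott (lie X Y) Z p.

(* The values at [p] of the tensors are obtained by extending tangent vectors
   at [p] to vector fields with constant coordinates in the chart [phi p]. *)
Definition torsion_at (p : M) (x y : 'rV[R]_d) : 'rV[R]_d :=
  torsion (cfield p x) (cfield p y) p.

Definition ricci_at (p : M) (y z : 'rV[R]_d) : R :=
  \sum_k curvature (cfield p (delta_mx 0 k)) (cfield p y) (cfield p z) p 0 k.

Definition covec (f : 'rV[R]_d -> R) : 'rV[R]_d := \row_j f (delta_mx 0 j).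
Definition endo (f : 'rV[R]_d -> 'rV[R]_d) : 'M[R]_d :=
  \matrix_j f (delta_mx 0 j).

(* [x *m Jmap p z] is the vector whose g-product with each [y] is
   g(z_V, T(x_H, y_H)); in particular it is horizontal. *)
Definition Jmap (p : M) (z : 'rV[R]_d) : 'M[R]_d :=
  endo (fun x => sharp g p
    (covec (fun y => gip g p (z *m vpr p) (torsion_at p (x *m hpr p) (y *m hpr p))))).

Definition J2 (p : M) : 'M[R]_d :=
  \sum_(l < m) Jmap p (vframe p l p) *m Jmap p (vframe p l p).

(* (nabla_W T)(X, Y) *)
Definition nabla_torsion (W X Y : vfield) : vfield := fun p =>
  bott W (torsion X Y) p - torsion (bott W X) Y p - torsion X (bott W Y) p.

Definition deltaT (p : M) : 'M[R]_d :=
  endo (fun x => - \sum_(j < n)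
    nabla_torsion (hframe p j) (hframe p j) (cfield p x) p).

Definition J2_form (eta : oneform) : oneform :=
  fun p => tensor_act g p (J2 p) (eta p).

Definition deltaT_form (eta : oneform) : oneform :=
  fun p => tensor_act g p (deltaT p) (eta p).

(* The one-form whose cometric product with each covector [c] at [p] is the
   Ricci curvature of the horizontal parts of the duals of [eta p] and [c]. *)
Definition ric_form (eta : oneform) : oneform := fun p =>
  covec (fun y => ricci_at p (sharp g p (eta p) *m hpr p) (y *m hpr p)).

Definition ip_h (p : M) (a b : 'rV[R]_d) : R :=
  cogip g p (a *m (hpr p)^T) (b *m (hpr p)^T).
Definition ip_v (p : M) (a b : 'rV[R]_d) : R :=
  cogip g p (a *m (vpr p)^T) (b *m (vpr p)^T).

Definition nabla_form (X : vfield) (eta : oneform) : oneform := fun p =>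
  covec (fun y => vder X (fun q => pairing (eta q) (cfield p y q)) p
                - pairing (eta p) (bott X (cfield p y) p)).

Definition hlaplacian (f : M -> R) : M -> R := fun p =>
  let X := hframe p in
  \sum_(i < n) (vder (X i) (vder (X i) f) p - vder (bott (X i) (X i)) f p).

Variable eps : R.

Definition ip_eps (p : M) (a b : 'rV[R]_d) : R := ip_h p a b + eps * ip_v p a b.

(* For [W] horizontal. *)
Definition Teps_form (W : vfield) (eta : oneform) : oneform := fun p =>
  covec (fun y => eps^-1 * pairing (eta p) (W p *m Jmap p (y *m vpr p))
                - pairing (eta p) (torsion_at p (W p) (y *m hpr p))).

Definition twisted (W : vfield) (eta : oneform) : oneform := fun p =>
  nabla_form W eta p - Teps_form W eta p.

(* The value at [p] of a section sum_i alpha_i (x) theta_i of the tensor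
   product of one-forms with horizontal one-forms is given by the family of
   the alpha_i, with respect to the frame [hframe p]. *)
Definition nablaH (eta : oneform) (p : M) : 'I_n -> 'rV[R]_d :=
  fun i => nabla_form (hframe p i) eta p.
Definition TepsH (eta : oneform) (p : M) : 'I_n -> 'rV[R]_d :=
  fun i => Teps_form (hframe p i) eta p.
Definition normsq_tensor (p : M) (alpha : 'I_n -> 'rV[R]_d) : R :=
  \sum_(i < n) ip_eps p (alpha i) (alpha i).

(* -(nabla_H - T_H^eps)^* (nabla_H - T_H^eps), through its expression in local
   orthonormal horizontal frames. *)
Definition rough_laplacian (eta : oneform) : oneform := fun p =>
  let X := hframe p in
  \sum_(i < n) (twisted (X i) (twisted (X i) eta) p
              - twisted (bott (X i) (X i)) eta p).

Definition square (eta : oneform) : oneform := fun p =>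
  rough_laplacian eta p - eps^-1 *: J2_form eta p
  + eps^-1 *: deltaT_form eta p - ric_form eta p.

End bott.

(* Main.v *)
Require Import Defs.
From HB Require Import structures.
From mathcomp Require Import all_boot all_order all_algebra.
From mathcomp Require Import ring lra.
From mathcomp Require Import all_classical all_reals all_analysis.
Import Order.TTheory GRing.Theory Num.Theory.
Import numFieldNormedType.Exports.
Local Open Scope classical_set_scope.
Local Open Scope ring_scope.

Set Implicit Arguments.
Unset Strict Implicit.
Unset Printing Implicit Defensive.

(** The identity holds because [twisted X = nabla_X - T_X] is a metric
    connection, for the norm of one-forms with parameter [eps], along every
    horizontal field [X] ([twisted_metric]).

    First, [nabla] is metric on each of the two factors. On horizontal fields it
    is the projection of the Levi-Civita connection. On vertical fields the
    bracket [[X, Y]_V] differs from [(D_X Y)_V] by [(D_Y X)_V], whose product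
    with a vertical [Z] is [- g(X, D_Y Z)]: this is the second fundamental form
    of the leaves, which is zero ([second_fundamental_form_eq0],
    [bott_metric_eps], [nabla_form_metric]). Secondly, [T_X] is skew: it maps
    horizontal to vertical forms by [J] with factor [1/eps], vertical to
    horizontal forms by minus the torsion, and these are adjoint up to sign
    once vertical forms have weight [eps] ([Teps_skew]).

    Hence, along each field [X] of the frame,
      [(1/2) X X |eta|^2 = <tw_X tw_X eta, eta> + |tw_X eta|^2],
      [(1/2) (nabla_X X) |eta|^2 = <tw_(nabla_X X) eta, eta>],
    where [nabla_X X] is horizontal again ([bochner_direction]). The sum over
    the frame equates half the horizontal Laplacian of [|eta|^2] with the rough
    Laplacian term plus [|nabla_H eta - T_H eta|^2]. The zero order terms of the
    operator have a type: [J^2 eta] and [Ric eta] are horizontal forms and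
    [deltaT eta] is vertical, because the torsion takes vertical values
    ([ip_v_J2], [ip_v_ric], [ip_h_deltaT]); so their products with [eta] at
    parameter [eps] are the horizontal one, and [eps] times the vertical one.

    To give these computations a meaning, smooth functions are shown to be
    stable under the ring operations and composition ([C1_differentiable],
    [Ck_on_comp]), so that all charts agree. The values at a point of the
    torsion and of the connection on forms are defined through fields with
    constant coordinates in a chart that depends on the point; they are
    compared with arbitrary fields by tensoriality ([tensorial],
    [torsion_atE], [nabla_formE]). Finally the projection on the horizontal
    bundle is smooth, since a local submersion expresses it by the gradients of
    its components ([hpr_submersion], [smooth_hpr]). *)

(** * Continuously differentiable functions are differentiable *)

Section dot.
Context {R : realType} {d : nat}.

Definition linform (c : 'cV[R]_d) (v : 'rV[R]_d) : R := (v *m c) 0 0.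

Lemma linform_linear c : linear (linform c).
Proof. by move=> a u v; rewrite /linform mulmxDl -scalemxAl !mxE. Qed.

HB.instance Definition _ c := GRing.isLinear.Build R _ R _ (linform c) (linform_linear c).

Lemma linformE c v : linform c v = \sum_i v 0 i * c i 0.
Proof. by rewrite /linform mxE. Qed.

Lemma linform_continuous c : continuous (linform c).
Proof.
rewrite (_ : linform c = fun w => \sum_i w 0 i * c i 0); last first.
  by apply/funext => w; rewrite linformE.
apply: continuous_big; first exact: add_continuous.
move=> i _ v; apply: (@continuousM _ _ (fun w : 'rV[R]_d => w 0 i) (cst (c i 0))).
  exact: coord_continuous.
exact: cst_continuous.
Qed.

End dot.

Section C1.
Context {R : realType} {d : nat}.
Implicit Types f : 'rV[R]_d -> R.
Local Notation e_ i := (delta_mx 0 i : 'rV[R]_d).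

Lemma derivable_line f (y e : 'rV[R]_d) (s : R) :
  derivable f (s *: e + y) e ->
  is_derive s 1 (fun t : R => f (t *: e + y)) ('D_e f (s *: e + y)).
Proof.
have E : (fun h => h^-1 *: (f ((h *: (1 : R) + s) *: e + y) - f (s *: e + y)))
  = (fun h => h^-1 *: (f (h *: e + (s *: e + y)) - f (s *: e + y))).
  by apply/funext => h; rewrite scalerDl -addrA [h *: 1]mulr1.
by move=> df; split; [rewrite /derivable E|rewrite /derive E].
Qed.

(** The mean value theorem along a coordinate line, for increments of either
    sign. *)
Lemma line_mean_value f (y e : 'rV[R]_d) (t : R) :
  (forall s : R, `|s| <= `|t| -> derivable f (s *: e + y) e) ->
  exists2 s : R, `|s| <= `|t| & f (t *: e + y) - f y = t * 'D_e f (s *: e + y).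
Proof.
move=> df.
have dg (s : R) : `|s| <= `|t| ->
  is_derive s 1 (fun t : R => f (t *: e + y)) ('D_e f (s *: e + y)).
  by move=> /df; exact: derivable_line.
have cg (s : R) : `|s| <= `|t| -> {for s, continuous (fun t : R => f (t *: e + y))}.
  move=> /dg [h _]; exact/differentiable_continuous/derivable1_diffP.
have [t0|t0] := leP 0 t.
- have [||c] := @MVT_segment R (fun t : R => f (t *: e + y))
    (fun s => 'D_e f (s *: e + y)) 0 t t0.
  + by move=> s; rewrite in_itv /= => /andP[s0 st]; apply: dg; rewrite !ger0_norm ?(ltW s0) ?(ltW st).
  + apply: continuous_in_subspaceT => s /set_mem; rewrite /= in_itv /= => /andP[s0 st].
    by apply: cg; rewrite !ger0_norm.
  rewrite in_itv /= => /andP[s0 st]; rewrite scale0r add0r subr0 mulrC => E.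
  by exists c => //; rewrite !ger0_norm.
- have [||c] := @MVT_segment R (fun t : R => f (t *: e + y))
    (fun s => 'D_e f (s *: e + y)) t 0 (ltW t0).
  + by move=> s; rewrite in_itv /= => /andP[s0 st]; apply: dg; rewrite !ler0_norm ?(ltW st) ?(ltW t0)// lerN2 ltW.
  + apply: continuous_in_subspaceT => s /set_mem; rewrite /= in_itv /= => /andP[s0 st].
    by apply: cg; rewrite !ler0_norm ?(ltW t0)// lerN2.
  rewrite in_itv /= => /andP[s0 st]; rewrite scale0r add0r sub0r mulrN mulrC => E.
  exists c; first by rewrite !ler0_norm ?(ltW t0)// lerN2.
  by rewrite -opprB E opprK.
Qed.

(** The partial sums of [h = sum_i h_i e_i]: they join [x] to [x + h] by a
    path that moves along one coordinate at a time. *)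
Definition head_coords (h : 'rV[R]_d) (k : nat) : 'rV[R]_d :=
  \row_i (if (i < k)%N then h 0 i else 0).

Lemma head_coordsS h (i : 'I_d) : head_coords h i.+1 = h 0 i *: e_ i + head_coords h i.
Proof.
apply/rowP => j; rewrite !mxE ltnS leq_eqVlt eq_sym.
have [->|ij] := eqVneq i j; first by rewrite eqxx/= ltnn mulr1 addr0.
by rewrite (negPf (_ : (i : nat) != j)) //= mulr0 add0r.
Qed.

Lemma row_coord_le_norm (h : 'rV[R]_d) i : `|h 0 i| <= `|h|.
Proof. by rewrite [leRHS]/Num.Def.normr/= mx_normrE; exact: (le_bigmax _ _ (0, i)). Qed.

Lemma norm_row_le (h : 'rV[R]_d) r : 0 <= r -> (forall i, `|h 0 i| <= r) -> `|h| <= r.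
Proof.
move=> r0 hr; rewrite [leLHS]/Num.Def.normr/= mx_normrE (bigmax_le _ r0)//= => -[i j] _ /=.
by rewrite (ord1 i).
Qed.

Definition grad f x : 'cV[R]_d := \col_i 'D_(e_ i) f x.

(** The increment of [f] telescopes along the path of [head_coords]; on each
    step the mean value theorem replaces it by a partial derivative at a point
    of the ball of radius [|h|], close to the one at [x]. *)
Lemma C1_differentiable f x :
  (\forall y \near x, forall i, derivable f y (e_ i)) ->
  (forall i, {for x, continuous ('D_(e_ i) f)}) ->
  differentiable f x /\ 'd f x = linform (grad f x) :> (_ -> _).
Proof.
move=> df cf.
have E : f \o shift x = cst (f x) + linform (grad f x) +o_ 0 id.
  apply/eqaddoP => _/posnumP[eps].
  have d0 : 0 < eps%:num / d.+1%:R by rewrite divr_gt0.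
  have : \forall y \near x, forall i, derivable f y (e_ i) /\
      `|'D_(e_ i) f x - 'D_(e_ i) f y| <= eps%:num / d.+1%:R.
    have H : \forall y \near x, forall i, `|'D_(e_ i) f x - 'D_(e_ i) f y| <= eps%:num / d.+1%:R.
      by apply: (@filter_forall _ _ (fun i y => `|'D_(e_ i) f x - 'D_(e_ i) f y| <= eps%:num / d.+1%:R) (nbhs x)) => i; have /cvgrPdist_le := cf i; exact.
    by apply: filterS2 df H => y dy hy i; split; [exact: dy|exact: hy].
  move=> /nbhs_ballP[r /= r0 rP].
  apply/nbhs_ballP; exists r => //= h.
  rewrite -ball_normE /= sub0r normrN => hr.
  have inb k (s : R) (i : 'I_d) : k = i :> nat -> `|s| <= `|h 0 i| ->
      ball x r (s *: e_ i + (head_coords h k + x)).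
    move=> ki sh; rewrite -ball_normE /= addrA -normrN opprB addrK.
    apply: le_lt_trans hr; apply: norm_row_le => // j; rewrite !mxE eqxx/= ki.
    have [->|ij] := eqVneq j i; first by rewrite mulr1 ltnn addr0 (le_trans sh)// row_coord_le_norm.
    by rewrite mulr0 add0r; case: ifP => _; rewrite ?normr0// row_coord_le_norm.
  have step (i : 'I_d) : `|f (head_coords h i.+1 + x) - f (head_coords h i + x)
       - h 0 i * 'D_(e_ i) f x| <= eps%:num / d.+1%:R * `|h|.
    have [|s sh] := @line_mean_value f (head_coords h i + x) (e_ i) (h 0 i).
      by move=> s sh; have := rP _ (inb i s i erefl sh) => /(_ i)[].
    rewrite addrA -head_coordsS => ->; rewrite -mulrBr normrM mulrC.
    apply: ler_pM => //; last exact: row_coord_le_norm.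
    by have := rP _ (inb i s i erefl sh) => /(_ i)[_]; rewrite distrC.
  have -> : (f \o shift x - (cst (f x) + linform (grad f x))) h =
     \sum_(i < d) (f (head_coords h i.+1 + x) - f (head_coords h i + x) - h 0 i * 'D_(e_ i) f x).
    rewrite sumrB.
    rewrite -(big_mkord xpredT (fun k => f (head_coords h k.+1 + x) - f (head_coords h k + x))).
    rewrite telescope_sumr//.
    rewrite (_ : head_coords h d = h); last by apply/rowP => j; rewrite !mxE ltn_ord.
    rewrite (_ : head_coords h 0 = 0); last by apply/rowP => j; rewrite !mxE ltn0.
    rewrite add0r [LHS]/= -/(f (h + x)) !fctE /= linformE opprD addrA; congr (_ - _).
    by apply: eq_bigr => i _; rewrite mxE.
  apply: (le_trans (ler_norm_sum _ _ _)).
  apply: (@le_trans _ _ (\sum_(i < d) eps%:num / d.+1%:R * `|h|)); first exact: ler_sum.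
  rewrite sumr_const card_ord -[_ *+ d]mulr_natl [X in X <= _]mulrA; apply: ler_wpM2r => //.
  by rewrite mulrCA ger_pMr// ler_pdivrMr// mul1r ler_nat.
have E' := diff_unique (@linform_continuous _ _ (grad f x)) E.
split=> //; apply/diff_locallyP; rewrite E'; split => //.
exact: linform_continuous.
Qed.

End C1.

(** * Smooth functions on open sets of coordinate space *)

Section Ck.
Context {R : realType} {d : nat}.
Implicit Types (f h : 'rV[R]_d -> R) (B : set 'rV[R]_d).
Local Notation e_ i := (delta_mx 0 i : 'rV[R]_d).

Lemma Ck_on_cont k B f : Ck_on k B f -> forall x, B x -> {for x, continuous f}.
Proof. by case: k => [|k] []. Qed.

Lemma Ck_onW k B f : Ck_on k.+1 B f -> Ck_on k B f.
Proof.
elim: k f => [|k IH] f /= [cf df]; first by split.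
by split=> // i; have [di ci] := df i; split => //; exact: IH.
Qed.

Lemma Ck_on_sub k B B' f : B' `<=` B -> Ck_on k B f -> Ck_on k B' f.
Proof.
move=> sB; elim: k f => [|k IH] f /= [cf df]; split=> //; try by move=> x /sB /cf.
by move=> i; have [di ci] := df i; split; [move=> x /sB /di|exact: IH].
Qed.

(** All the conditions in [Ck_on] are pointwise in the set. *)
Lemma Ck_on_local k B f : (forall x, B x -> exists2 B', B' x & Ck_on k B' f) ->
  Ck_on k B f.
Proof.
elim: k f => [|k IH] f H /=; split=> //; try by move=> x /H[B' xB'] [/(_ _ xB')].
move=> i; split; first by move=> x /H[B' xB'] [_ /(_ i)[/(_ _ xB')]].
by apply: IH => x /H[B' xB'] [_ /(_ i)[_ c]]; exists B'.
Qed.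

Lemma open_near_eq (T : topologicalType) (W : Type) (B : set T) (f h : T -> W) :
  open B -> (forall x, B x -> f x = h x) -> forall x, B x -> {near x, f =1 h}.
Proof. by move=> oB fh x Bx; near=> y; apply: fh; near: y; exact: open_nbhs_nbhs.
Unshelve. all: by end_near. Qed.

Lemma near_eq_continuous (T W : topologicalType) (f h : T -> W) x :
  {near x, f =1 h} -> {for x, continuous f} -> {for x, continuous h}.
Proof.
move=> fh; rewrite /prop_for /continuous_at -(nbhs_singleton fh) => cf.
by apply: cvg_trans cf; apply: (near_eq_cvg fh).
Qed.

Lemma Ck_on_eq k B f h : open B -> (forall x, B x -> f x = h x) ->
  Ck_on k B f -> Ck_on k B h.
Proof.
move=> oB; elim: k f h => [|k IH] f h fh /= [cf df]; split=> //;
  try by move=> x Bx; apply: (near_eq_continuous (open_near_eq oB fh Bx)); exact: cf.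
move=> i; have [di ci] := df i; split.
    by move=> x Bx; exact: near_eq_derivable (open_near_eq oB fh Bx) (di _ Bx).
  apply: IH ci => x Bx; apply: near_eq_derive; exact: open_near_eq oB fh _ Bx.
Qed.

Lemma Ck_on_cst k B (c : R) : Ck_on k B (cst c).
Proof.
elim: k c => [|k IH] c /=; split=> //; try by move=> x _; exact: cst_continuous.
move=> i; split; first by move=> x _; exact: derivable_cst.
rewrite (_ : (fun x => _) = cst 0); first exact: IH.
by apply/funext => x; rewrite derive_cst.
Qed.

Lemma Ck_onD k B f h : open B -> Ck_on k B f -> Ck_on k B h ->
  Ck_on k B (fun x => f x + h x).
Proof.
move=> oB; elim: k f h => [|k IH] f h /= [cf df] [ch dh]; split=> //;
  try by move=> x Bx; apply: continuousD; [exact: cf|exact: ch].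
move=> i; have [dfi cfi] := df i; have [dhi chi] := dh i; split.
  by move=> x Bx; apply: derivableD; [exact: dfi|exact: dhi].
apply: Ck_on_eq (IH _ _ cfi chi) => // x Bx; rewrite -deriveD//;
  [exact: dfi|exact: dhi].
Qed.

Lemma Ck_onM k B f h : open B -> Ck_on k B f -> Ck_on k B h ->
  Ck_on k B (fun x => f x * h x).
Proof.
move=> oB; elim: k f h => [|k IH] f h.
  by move=> [cf _] [ch _]; split=> // x Bx; apply: continuousM; [exact: cf|exact: ch].
move=> Hf Hh; have [cf df] := Hf; have [ch dh] := Hh; split=> /=.
  by move=> x Bx; apply: continuousM; [exact: cf|exact: ch].
move=> i; have [dfi cfi] := df i; have [dhi chi] := dh i; split.
  by move=> x Bx; apply: derivableM; [exact: dfi|exact: dhi].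
apply: Ck_on_eq (Ck_onD oB (IH _ _ (Ck_onW Hf) chi) (IH _ _ (Ck_onW Hh) cfi)) => //.
by move=> x Bx; rewrite [RHS](deriveM (dfi _ Bx) (dhi _ Bx)).
Qed.

Lemma Ck_on_sum k B (I : Type) (r : seq I) (F : I -> 'rV[R]_d -> R) : open B ->
  (forall i, Ck_on k B (F i)) -> Ck_on k B (fun x => \sum_(i <- r) F i x).
Proof.
move=> oB HF; elim: r => [|a r IH].
  by apply: Ck_on_eq (Ck_on_cst k B 0) => // x Bx; rewrite big_nil.
by apply: Ck_on_eq (Ck_onD oB (HF a) IH) => // x Bx; rewrite big_cons.
Qed.

Lemma Ck_onV k B f : open B -> (forall x, B x -> f x != 0) -> Ck_on k B f ->
  Ck_on k B (fun x => (f x)^-1).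
Proof.
move=> oB f0; elim: k => [|k IH] Hf.
  by have [cf _] := Hf; split=> // x Bx; apply: continuousV; [exact: f0|exact: cf].
have [cf df] := Hf; split=> /=.
  by move=> x Bx; apply: continuousV; [exact: f0|exact: cf].
move=> i; have [dfi cfi] := df i; split.
  by move=> x Bx; apply: derivableV; [exact: f0|exact: dfi].
have IHf := IH (Ck_onW Hf).
have C1 := Ck_onM oB (Ck_onM oB IHf IHf) (Ck_onM oB (Ck_on_cst k B (-1)) cfi).
apply: Ck_on_eq C1 => // x Bx; rewrite [RHS](deriveV (f0 _ Bx) (dfi _ Bx)) /GRing.scale /=.
by rewrite mulN1r mulrN mulNr expr2 invfM.
Qed.

Lemma Ck_on_differentiable k B f x : open B -> Ck_on k.+1 B f -> B x ->
  differentiable f x /\ 'd f x = linform (grad f x) :> (_ -> _).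
Proof.
move=> oB [_ df] Bx; apply: C1_differentiable.
  near=> y => i; have [di _] := df i; apply: di; near: y; exact: open_nbhs_nbhs.
by move=> i; have [_ ci] := df i; exact: Ck_on_cont ci _ Bx.
Unshelve. all: by end_near. Qed.

End Ck.

Section composition.
Context {R : realType} {d d' : nat}.
Local Notation e_ i := (delta_mx 0 i).

Lemma row_continuous (T : topologicalType) (h : T -> 'rV[R]_d) x :
  (forall j, {for x, continuous (fun y => h y 0 j)}) -> {for x, continuous h}.
Proof.
move=> ch; apply/cvgrPdist_le => e e0.
have H : \forall y \near x, forall j, `|h x 0 j - h y 0 j| <= e.
  apply: (@filter_forall _ _ (fun j y => `|h x 0 j - h y 0 j| <= e) (nbhs x)) => j.
  by have /cvgrPdist_le := ch j; exact.
apply: filterS H => y hy; apply: norm_row_le => [|i]; first exact: ltW.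
by rewrite !mxE; exact: hy.
Qed.

Lemma row_differentiable (V : normedModType R) (h : V -> 'rV[R]_d) x :
  (forall j, differentiable (fun y => h y 0 j) x) -> differentiable h x.
Proof.
move=> dh; rewrite (_ : h = \sum_(j < d) (fun y => h y 0 j *: e_ j)); last first.
  by apply/funext => y; rewrite fct_sumE -row_sum_delta.
by apply: differentiable_sum => j; apply: differentiableZl; exact: dh.
Qed.

Lemma row_derive (V : normedModType R) (h : V -> 'rV[R]_d) x v :
  differentiable h x -> 'D_v h x = \row_j 'D_v (fun y => h y 0 j) x.
Proof.
by move=> dh; rewrite derive_mx; [apply/rowP => j; rewrite !mxE|exact: diff_derivable].
Qed.

Lemma derive_comp_row (f : 'rV[R]_d -> R) (V : normedModType R) (h : V -> 'rV[R]_d) x v :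
  differentiable f (h x) -> 'd f (h x) = linform (grad f (h x)) :> (_ -> _) ->
  (forall j, differentiable (fun y => h y 0 j) x) ->
  derivable (f \o h) x v /\
  'D_v (f \o h) x = \sum_j 'D_(e_ j) f (h x) * 'D_v (fun y => h y 0 j) x.
Proof.
move=> df gf dhj; have dh := row_differentiable dhj.
have dfh : differentiable (f \o h) x by exact: differentiable_comp.
split; first exact: diff_derivable.
rewrite deriveE// diff_comp//= gf -deriveE// row_derive// linformE.
by apply: eq_bigr => j _; rewrite !mxE mulrC.
Qed.

(** Induction on [k]: by the chain rule the partial derivatives of [f \o h] are
    sums of products of [(partial_j f) \o h], to which the induction hypothesis
    applies, with partial derivatives of [h]. *)
Lemma Ck_on_comp k (B : set 'rV[R]_d') (B' : set 'rV[R]_d) (h : 'rV[R]_d' -> 'rV[R]_d)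
    (f : 'rV[R]_d -> R) : open B -> open B' ->
  (forall x, B x -> B' (h x)) -> (forall j, Ck_on k B (fun x => h x 0 j)) ->
  Ck_on k B' f -> Ck_on k B (f \o h).
Proof.
move=> oB oB' hB; elim: k f => [|k IH] f Hh Hf.
  split=> // x Bx; apply: continuous_comp; last exact: (Ck_on_cont Hf (hB _ Bx)).
  by apply: row_continuous => j; exact: (Ck_on_cont (Hh j) Bx).
have D x (Bx : B x) i : derivable (f \o h) x (e_ i) /\
  'D_(e_ i) (f \o h) x = \sum_j 'D_(e_ j) f (h x) * 'D_(e_ i) (fun y => h y 0 j) x.
  have [df gf] := Ck_on_differentiable oB' Hf (hB _ Bx).
  apply: derive_comp_row => // j.
  by have [] := Ck_on_differentiable oB (Hh j) Bx.
split=> [x Bx|i].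
  apply: continuous_comp; last exact: (Ck_on_cont Hf (hB _ Bx)).
  by apply: row_continuous => j; exact: (Ck_on_cont (Hh j) Bx).
split=> [x Bx|]; first by have [] := D _ Bx i.
apply: (@Ck_on_eq _ _ _ _ (fun x =>
  \sum_j 'D_(e_ j) f (h x) * 'D_(e_ i) (fun y => h y 0 j) x)) => //.
  by move=> x Bx; have [_ ->] := D _ Bx i.
apply: Ck_on_sum => // j; apply: Ck_onM => //; last by have [_ /(_ i)[]] := Hh j.
by apply: (IH ('D_(e_ j) f)) => [j'|]; [exact: Ck_onW|have [_ /(_ j)[]] := Hf].
Qed.

End composition.

(** * Smooth functions and tangent vectors in charts *)

Section functions.
Context {R : realType} {d : nat} {M : topologicalType} (A : atlas R d M).
Implicit Types (U W : set M) (f h : M -> R) (X Y : vfield R d M).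
Local Notation e_ i := (delta_mx 0 i : 'rV[R]_d).

Lemma psiK a y : (phi A a @` dom A a) y -> phi A a (psi A a y) = y /\ dom A a (psi A a y).
Proof. by move=> [q aq <-]; rewrite phiK. Qed.

Lemma chart_imgP a U y : (phi A a @` (U `&` dom A a)) y <->
  (phi A a @` dom A a) y /\ U (psi A a y).
Proof.
split=> [[q [Uq aq] <-]|[[q aq <-]]]; first by rewrite phiK//; split=> //; exists q.
by rewrite phiK// => Uq; exists q.
Qed.

Lemma chart_img_open a U : open U -> open (phi A a @` (U `&` dom A a)).
Proof.
move=> oU; rewrite openE => y /chart_imgP[iy Uy]; rewrite /interior.
have Hp : nbhs y (phi A a @` dom A a) by apply: open_nbhs_nbhs; split=> //; exact: img_open.
have Hc : nbhs y (psi A a @^-1` U).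
  by apply: (psi_continuous iy); exact: open_nbhs_nbhs.
by apply: filterS2 Hp Hc => z iz Uz; apply/chart_imgP.
Qed.

Lemma chart_img_near a q U : open U -> U q -> dom A a q ->
  \forall y \near phi A a q, (phi A a @` (U `&` dom A a)) y.
Proof.
by move=> oU Uq aq; apply: open_nbhs_nbhs; split; [exact: chart_img_open|exists q].
Qed.

Lemma smooth_fun_sub U W f : W `<=` U -> smooth_fun A U f -> smooth_fun A W f.
Proof.
move=> WU sf a k; apply: Ck_on_sub (sf a k) => y /chart_imgP[iy Wy]; apply/chart_imgP.
by split=> //; exact: WU.
Qed.

Lemma smooth_fun_local U f :
  (forall q, U q -> exists2 W, W q & smooth_fun A W f) -> smooth_fun A U f.
Proof.
move=> H a k; apply: Ck_on_local => y /chart_imgP[iy /H[W Wy sf]].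
by exists (phi A a @` (W `&` dom A a)); [apply/chart_imgP|exact: sf].
Qed.

Lemma smooth_fun_eq U f h : open U -> (forall q, U q -> f q = h q) ->
  smooth_fun A U f -> smooth_fun A U h.
Proof.
move=> oU fh sf a k; apply: Ck_on_eq (sf a k); first exact: chart_img_open.
by move=> y /chart_imgP[iy Uy]; exact: fh.
Qed.

Lemma smooth_fun_cst U (c : R) : smooth_fun A U (fun=> c).
Proof. by move=> a k; exact: Ck_on_cst. Qed.

Lemma smooth_funD U f h : open U -> smooth_fun A U f -> smooth_fun A U h ->
  smooth_fun A U (fun q => f q + h q).
Proof. by move=> oU sf sh a k; apply: Ck_onD (sf a k) (sh a k); exact: chart_img_open. Qed.

Lemma smooth_funM U f h : open U -> smooth_fun A U f -> smooth_fun A U h ->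
  smooth_fun A U (fun q => f q * h q).
Proof. by move=> oU sf sh a k; apply: Ck_onM (sf a k) (sh a k); exact: chart_img_open. Qed.

Lemma smooth_funN U f : open U -> smooth_fun A U f -> smooth_fun A U (fun q => - f q).
Proof.
move=> oU sf; apply: smooth_fun_eq (smooth_funM oU (smooth_fun_cst U (-1)) sf) => // q _.
by rewrite mulN1r.
Qed.

Lemma smooth_funB U f h : open U -> smooth_fun A U f -> smooth_fun A U h ->
  smooth_fun A U (fun q => f q - h q).
Proof. by move=> oU sf sh; exact: (smooth_funD oU sf (smooth_funN oU sh)). Qed.

Lemma smooth_funV U f : open U -> (forall q, U q -> f q != 0) -> smooth_fun A U f ->
  smooth_fun A U (fun q => (f q)^-1).
Proof.
move=> oU f0 sf a k; apply: Ck_onV (sf a k); first exact: chart_img_open.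
by move=> y /chart_imgP[_ Uy]; exact: f0.
Qed.

Lemma smooth_fun_sum U (I : Type) (r : seq I) (P : pred I) (F : I -> M -> R) : open U ->
  (forall i, smooth_fun A U (F i)) -> smooth_fun A U (fun q => \sum_(i <- r | P i) F i q).
Proof.
move=> oU HF; elim: r => [|a r IH].
  by apply: smooth_fun_eq (smooth_fun_cst U 0) => // q _; rewrite big_nil.
case Pa : (P a).
  by apply: smooth_fun_eq (smooth_funD oU (HF a) IH) => // q _; rewrite big_cons Pa.
by apply: smooth_fun_eq IH => // q _; rewrite big_cons Pa.
Qed.

Lemma smooth_fun_prod U (I : Type) (r : seq I) (P : pred I) (F : I -> M -> R) : open U ->
  (forall i, smooth_fun A U (F i)) -> smooth_fun A U (fun q => \prod_(i <- r | P i) F i q).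
Proof.
move=> oU HF; elim: r => [|a r IH].
  by apply: smooth_fun_eq (smooth_fun_cst U 1) => // q _; rewrite big_nil.
case Pa : (P a).
  by apply: smooth_fun_eq (smooth_funM oU (HF a) IH) => // q _; rewrite big_cons Pa.
by apply: smooth_fun_eq IH => // q _; rewrite big_cons Pa.
Qed.

(** Smoothness read in one chart is smoothness in all charts, since the
    transition maps are smooth. *)
Lemma smooth_fun_chart a U f : open U ->
  smooth_on (phi A a @` (U `&` dom A a)) (f \o psi A a) -> smooth_fun A (U `&` dom A a) f.
Proof.
move=> oU sf b k.
have oUa : open (U `&` dom A a) by apply: openI => //; exact: dom_open.
have C : Ck_on k (phi A b @` (U `&` dom A a `&` dom A b))
    ((f \o psi A a) \o (phi A a \o psi A b)).
  apply: (@Ck_on_comp _ _ _ _ _ (phi A a @` (U `&` dom A a))); last exact: sf.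
  - exact: chart_img_open.
  - exact: chart_img_open.
  - by move=> y /chart_imgP[iy [Uy ay]]; exists (psi A b y).
  - move=> j; apply: Ck_on_sub (transition_smooth A b a j k).
    by move=> y [q [[Uq aq] bq] <-]; exists q.
apply: Ck_on_eq C; first exact: chart_img_open.
by move=> y /chart_imgP[iy [Uy ay]] /=; rewrite phiK.
Qed.

Lemma smooth_coord a i : smooth_fun A (dom A a) (fun q => phi A a q 0 i).
Proof. by move=> b k; rewrite setIC; exact: transition_smooth. Qed.

Lemma smooth_fun_diff U a q f : open U -> smooth_fun A U f -> U q -> dom A a q ->
  differentiable (f \o psi A a) (phi A a q) /\
  'd (f \o psi A a) (phi A a q) = linform (grad (f \o psi A a) (phi A a q)) :> (_ -> _).
Proof.
move=> oU sf Uq aq.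
have B : (phi A a @` (U `&` dom A a)) (phi A a q) by exists q.
have [H1 H2] := Ck_on_differentiable (chart_img_open oU) (sf a 1%N) B.
split; first exact: H1.
exact: H2.
Qed.

Lemma tderE U q f : open U -> smooth_fun A U f -> U q -> forall v,
  tder A q v f = linform (grad (f \o psi A q) (phi A q q)) v.
Proof.
move=> oU sf Uq v; have [df gf] := smooth_fun_diff oU sf Uq (dom_mem A q).
by rewrite /tder deriveE// gf.
Qed.

Lemma derivable_chart U a q f v : open U -> smooth_fun A U f -> U q -> dom A a q ->
  derivable (f \o psi A a) (phi A a q) v.
Proof.
by move=> oU sf Uq aq; have [df gf] := smooth_fun_diff oU sf Uq aq; exact: diff_derivable.
Qed.

Lemma tder_eq U q v f h : open U -> U q -> (forall r, U r -> f r = h r) ->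
  tder A q v f = tder A q v h.
Proof.
move=> oU Uq fh; apply: near_eq_derive.
by apply: filterS (chart_img_near oU Uq (dom_mem A q)) => y /chart_imgP[_ /fh].
Qed.

Lemma tder_cst q v (c : R) : tder A q v (fun=> c) = 0.
Proof. exact: derive_cst. Qed.

Lemma tderD U q v f h : open U -> smooth_fun A U f -> smooth_fun A U h -> U q ->
  tder A q v (fun r => f r + h r) = tder A q v f + tder A q v h.
Proof.
move=> oU sf sh Uq.
exact: deriveD (derivable_chart oU sf Uq (dom_mem A q))
  (derivable_chart oU sh Uq (dom_mem A q)).
Qed.

Lemma tderM U q v f h : open U -> smooth_fun A U f -> smooth_fun A U h -> U q ->
  tder A q v (fun r => f r * h r) = f q * tder A q v h + h q * tder A q v f.
Proof.
move=> oU sf sh Uq.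
have /(_ v) := deriveM (derivable_chart oU sf Uq (dom_mem A q))
  (derivable_chart oU sh Uq (dom_mem A q)).
by rewrite /= (phiK (dom_mem A q)).
Qed.

Lemma tder_vD U q f u v : open U -> smooth_fun A U f -> U q ->
  tder A q (u + v) f = tder A q u f + tder A q v f.
Proof. by move=> oU sf Uq; rewrite !(tderE oU sf Uq) linearD. Qed.

Lemma tder_vZ U q f (c : R) v : open U -> smooth_fun A U f -> U q ->
  tder A q (c *: v) f = c * tder A q v f.
Proof. by move=> oU sf Uq; rewrite !(tderE oU sf Uq) linearZ. Qed.

Lemma tder_v0 q f : tder A q 0 f = 0.
Proof. exact: derive0. Qed.

Lemma tder_vsum U q f (I : Type) (r : seq I) (v : I -> 'rV[R]_d) :
  open U -> smooth_fun A U f -> U q ->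
  tder A q (\sum_(i <- r) v i) f = \sum_(i <- r) tder A q (v i) f.
Proof.
move=> oU sf Uq; elim: r => [|a r IH]; first by rewrite !big_nil tder_v0.
by rewrite !big_cons (tder_vD _ _ oU sf Uq) IH.
Qed.

(** The partial derivative in the chart at [a], as a function on the
    manifold. *)
Definition pder a (i : 'I_d) f : M -> R := fun q => 'D_(e_ i) (f \o psi A a) (phi A a q).

Lemma pder_smooth a i U f : open U -> smooth_fun A U f ->
  smooth_fun A (U `&` dom A a) (pder a i f).
Proof.
move=> oU sf; apply: smooth_fun_chart => // k.
have [_ /(_ i)[_ C]] := sf a k.+1.
apply: Ck_on_eq C; first exact: chart_img_open.
by move=> y /chart_imgP[iy Uy]; rewrite /pder /= (psiK iy).1.
Qed.

Lemma transition_near a b q f U : open U -> U q -> dom A a q -> dom A b q ->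
  \forall y \near phi A b q, (f \o psi A b) y = ((f \o psi A a) \o (phi A a \o psi A b)) y.
Proof.
move=> oU Uq aq bq.
have := chart_img_near (openI oU (dom_open A a)) (conj Uq aq) bq.
by apply: filterS => y /chart_imgP[iy [Uy ay]] /=; rewrite phiK.
Qed.

(** The chain rule for [f \o psi_b = (f \o psi_a) \o (phi_a \o psi_b)]. Both
    the action of a tangent vector read in another chart and the action of a
    coordinate field are instances of it. *)
Lemma derive_transition a b q f U v : open U -> smooth_fun A U f -> U q ->
  dom A a q -> dom A b q ->
  'D_v (f \o psi A b) (phi A b q) =
  \sum_j pder a j f q * 'D_v (fun y => phi A a (psi A b y) 0 j) (phi A b q).
Proof.
move=> oU sf Uq aq bq.
have hq : (phi A a \o psi A b) (phi A b q) = phi A a q by rewrite /= phiK.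
have [df gf] := smooth_fun_diff oU sf Uq aq.
have [||j|_ H] := @derive_comp_row R d (f \o psi A a) _ (phi A a \o psi A b) (phi A b q) v.
- by rewrite hq.
- by rewrite hq.
- by have [] := smooth_fun_diff (dom_open A a) (smooth_coord a j) aq bq.
rewrite (near_eq_derive _ (transition_near f oU Uq aq bq)) H.
by apply: eq_bigr => j _; rewrite /pder hq.
Qed.

Lemma tder_chart a q f U v : open U -> smooth_fun A U f -> U q -> dom A a q ->
  tder A q v f = \sum_j pder a j f q * tder A q v (fun r => phi A a r 0 j).
Proof. by move=> oU sf Uq aq; exact: (derive_transition v oU sf Uq aq (dom_mem A q)). Qed.

Lemma cfieldE a q x U f : open U -> smooth_fun A U f -> U q -> dom A a q ->
  vder A (cfield A a x) f q = 'D_x (f \o psi A a) (phi A a q).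
Proof.
move=> oU sf Uq aq; rewrite /vder (tderE oU sf Uq).
rewrite (derive_transition x oU sf Uq (dom_mem A q) aq) linformE.
have dh : differentiable (phi A q \o psi A a) (phi A a q).
  apply: row_differentiable => j.
  by have [] := smooth_fun_diff (dom_open A q) (smooth_coord q j) (dom_mem A q) aq.
by rewrite /cfield row_derive//; apply: eq_bigr => j _; rewrite !mxE mulrC.
Qed.

Lemma derive_coord a q x i : dom A a q ->
  'D_x ((fun r => phi A a r 0 i) \o psi A a) (phi A a q) = x 0 i.
Proof.
move=> aq; rewrite (near_eq_derive (g := linform (delta_mx i 0))); last first.
  apply: filterS (chart_img_near openT I aq) => y /chart_imgP[iy _] /=; rewrite (psiK iy).1.
  by rewrite /linform -colE mxE.
have c := @linform_continuous R d (delta_mx i 0).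
by rewrite deriveE ?diff_lin//; [rewrite /= /linform -colE mxE|exact: linear_differentiable].
Qed.

Lemma cfield_coord a q x i : dom A a q ->
  vder A (cfield A a x) (fun r => phi A a r 0 i) q = x 0 i.
Proof.
by move=> aq; rewrite (cfieldE _ (dom_open A a) (smooth_coord a i))// derive_coord.
Qed.

Lemma tder_coord q x i : tder A q x (fun r => phi A q r 0 i) = x 0 i.
Proof. exact: derive_coord (dom_mem A q). Qed.

(** A tangent vector at [q] is stored by its coordinates in the chart at [q];
    it is as well determined by its action on the coordinates of any chart
    around [q]. *)
Lemma tangent_vector_eq a q u v : dom A a q ->
  (forall i, tder A q u (fun r => phi A a r 0 i) = tder A q v (fun r => phi A a r 0 i)) ->
  u = v.
Proof.
move=> aq H; apply/rowP => i; rewrite -!(tder_coord q).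
rewrite !(tder_chart _ (dom_open A q) (smooth_coord q i) (dom_mem A q) aq).
by apply: eq_bigr => j _; rewrite H.
Qed.

Lemma cfield_self q x : cfield A q x q = x.
Proof.
apply: (tangent_vector_eq (dom_mem A q)) => i.
by have := cfield_coord x i (dom_mem A q); rewrite /vder => ->; rewrite tder_coord.
Qed.

Lemma coordinate_decomp a q v : dom A a q ->
  v = \sum_i tder A q v (fun r => phi A a r 0 i) *: cfield A a (e_ i) q.
Proof.
move=> aq; apply: (tangent_vector_eq aq) => i; have sc := smooth_coord a i.
rewrite (tder_vsum _ _ (dom_open A a) sc aq) (bigD1 i)//= big1 => [|j ji].
  rewrite (tder_vZ _ _ (dom_open A a) sc aq) -[tder A q (cfield _ _ _ _) _]/(vder A (cfield A a _) _ q) cfield_coord//.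
  by rewrite !mxE !eqxx mulr1 addr0.
rewrite (tder_vZ _ _ (dom_open A a) sc aq) -[tder A q (cfield _ _ _ _) _]/(vder A (cfield A a _) _ q) cfield_coord//.
by rewrite !mxE eq_sym (negPf ji) mulr0.
Qed.

End functions.

(** * Vector fields and tensoriality *)

Section vector_fields.
Context {R : realType} {d : nat} {M : topologicalType} (A : atlas R d M).
Implicit Types (U W : set M) (f h : M -> R) (X Y : vfield R d M).
Local Notation e_ i := (delta_mx 0 i : 'rV[R]_d).

Lemma smooth_vfield_sub U W X : W `<=` U -> smooth_vfield A U X -> smooth_vfield A W X.
Proof. by move=> WU sX a i; apply: smooth_fun_sub (sX a i) => q [/WU]. Qed.

Lemma smooth_vfield_eq U X Y : open U -> (forall q, U q -> X q = Y q) ->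
  smooth_vfield A U X -> smooth_vfield A U Y.
Proof.
move=> oU XY sX a i; apply: smooth_fun_eq (sX a i).
  by apply: openI => //; exact: dom_open.
by move=> q [Uq _]; rewrite /vder XY.
Qed.

Lemma smooth_vfield_local U X :
  (forall q, U q -> exists2 W, W q & smooth_vfield A W X) -> smooth_vfield A U X.
Proof.
move=> H a i; apply: smooth_fun_local => q [Uq aq]; have [W Wq sX] := H _ Uq.
by exists (W `&` dom A a).
Qed.

Lemma vder_smooth U X f : open U -> smooth_vfield A U X -> smooth_fun A U f ->
  smooth_fun A U (vder A X f).
Proof.
move=> oU sX sf; apply: smooth_fun_local => q Uq; exists (U `&` dom A q).
  by split=> //; exact: dom_mem.
have oUq : open (U `&` dom A q) by apply: openI => //; exact: dom_open.
apply: (@smooth_fun_eq _ _ _ _ _ (fun r =>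
  \sum_j pder A q j f r * vder A X (fun r => phi A q r 0 j) r)) => //.
  by move=> r [Ur qr]; rewrite [RHS](tder_chart _ oU sf Ur qr).
by apply: smooth_fun_sum => // j; apply: smooth_funM => //; exact: pder_smooth.
Qed.

Lemma smooth_vfield0 U : smooth_vfield A U (fun=> 0).
Proof.
move=> a i; rewrite (_ : vder _ _ _ = fun=> 0); first exact: smooth_fun_cst.
by apply/funext => q; exact: tder_v0.
Qed.

Lemma smooth_vfieldD U X Y : open U -> smooth_vfield A U X -> smooth_vfield A U Y ->
  smooth_vfield A U (fun q => X q + Y q).
Proof.
move=> oU sX sY a i; have oUa : open (U `&` dom A a) by apply: openI => //; exact: dom_open.
apply: smooth_fun_eq (smooth_funD oUa (sX a i) (sY a i)) => // q [Uq aq].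
by rewrite [RHS](tder_vD _ _ (dom_open A a) (smooth_coord A a i) aq).
Qed.

Lemma smooth_vfieldZ U f X : open U -> smooth_fun A U f -> smooth_vfield A U X ->
  smooth_vfield A U (fun q => f q *: X q).
Proof.
move=> oU sf sX a i; have oUa : open (U `&` dom A a) by apply: openI => //; exact: dom_open.
have sfa : smooth_fun A (U `&` dom A a) f by apply: smooth_fun_sub sf => q [].
apply: smooth_fun_eq (smooth_funM oUa sfa (sX a i)) => // q [Uq aq].
by rewrite [RHS](tder_vZ _ _ (dom_open A a) (smooth_coord A a i) aq).
Qed.

Lemma smooth_vfieldN U X : open U -> smooth_vfield A U X ->
  smooth_vfield A U (fun q => - X q).
Proof.
move=> oU sX; apply: smooth_vfield_eq (smooth_vfieldZ oU (smooth_fun_cst A U (-1)) sX) => //.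
by move=> q _; rewrite scaleN1r.
Qed.

Lemma smooth_vfieldB U X Y : open U -> smooth_vfield A U X -> smooth_vfield A U Y ->
  smooth_vfield A U (fun q => X q - Y q).
Proof. by move=> oU sX sY; exact: (smooth_vfieldD oU sX (smooth_vfieldN oU sY)). Qed.

Lemma smooth_vfield_sum U (I : Type) (r : seq I) (F : I -> vfield R d M) : open U ->
  (forall i, smooth_vfield A U (F i)) -> smooth_vfield A U (fun q => \sum_(i <- r) F i q).
Proof.
move=> oU HF; elim: r => [|a r IH].
  by apply: smooth_vfield_eq (smooth_vfield0 U) => // q _; rewrite big_nil.
by apply: smooth_vfield_eq (smooth_vfieldD oU (HF a) IH) => // q _; rewrite big_cons.
Qed.

Lemma smooth_cfield a x : smooth_vfield A (dom A a) (cfield A a x).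
Proof.
move=> b i; apply: smooth_fun_local => q [aq bq]; exists (dom A a `&` dom A b) => //.
have oab : open (dom A a `&` dom A b) by apply: openI; exact: dom_open.
apply: (@smooth_fun_eq _ _ _ _ _ (fun r =>
   \sum_j x 0 j * pder A a j (fun r => phi A b r 0 i) r)) => //.
  move=> r [ar br]; rewrite (cfieldE _ (dom_open A b) (smooth_coord A b i))//.
  have [df gf] := smooth_fun_diff (dom_open A b) (smooth_coord A b i) br ar.
  by rewrite deriveE// gf linformE; apply: eq_bigr => j _; rewrite mxE.
apply: smooth_fun_sum => // j; apply: smooth_funM => //; first exact: smooth_fun_cst.
rewrite setIC; apply: pder_smooth; [exact: dom_open|exact: smooth_coord].
Qed.

(** An expression that is additive and linear over functions in a vector field
    depends only on the value of the field at the point. The linearity is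
    assumed on all small open sets, which makes it local: see
    [tensorial_germ]. *)
Section tensorial.
Variables (W : lmodType R) (L : vfield R d M -> W) (q : M) (U : set M).
Hypotheses (oU : open U) (Uq : U q).
Hypothesis LD : forall V X Y, open V -> V q -> V `<=` U ->
  smooth_vfield A V X -> smooth_vfield A V Y -> L (fun r => X r + Y r) = L X + L Y.
Hypothesis LZ : forall V f X, open V -> V q -> V `<=` U ->
  smooth_fun A V f -> smooth_vfield A V X -> L (fun r => f r *: X r) = f q *: L X.


(** A field that vanishes on [V] is its own product with the indicator of the
    complement of [V], a function that is smooth on [V] and zero at [q]. *)
Lemma tensorial_germ V X : open V -> V q -> V `<=` U ->
  (forall r, V r -> X r = 0) -> L X = 0.
Proof.
move=> oV Vq VU X0; pose c r : R := if `[< V r >] then 0 else 1.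
have sX : smooth_vfield A V X.
  by apply: smooth_vfield_eq (smooth_vfield0 V) => // r Vr; rewrite X0.
have sc : smooth_fun A V c.
  by apply: smooth_fun_eq (smooth_fun_cst A V 0) => // r Vr; rewrite /c asboolT.
have -> : X = fun r => c r *: X r.
  apply/funext => r; rewrite /c; case: asboolP => Vr; last by rewrite scale1r.
  by rewrite X0// scaler0.
by rewrite (LZ oV Vq VU sc sX) /c asboolT// scale0r.
Qed.

(** Near [q] the field is [sum_i c_i d_i] with coordinate fields [d_i] and
    coefficients that vanish at [q]; the difference with that sum, defined
    everywhere, has zero germ. *)
Lemma tensorial0 V X : open V -> V q -> V `<=` U ->
  smooth_vfield A V X -> X q = 0 -> L X = 0.
Proof.
move=> oV' Vq' VU' sX Xq; pose W' := V `&` dom A q.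
have oV : open W' by apply: openI => //; exact: dom_open.
have Vq : W' q by split=> //; exact: dom_mem.
have VU : W' `<=` U by move=> r [/VU'].
have L0 : L (fun=> 0) = 0 by apply: (tensorial_germ oV Vq VU).
pose c i := vder A X (fun r => phi A q r 0 i).
pose S (s : seq 'I_d) : vfield R d M := fun r => \sum_(i <- s) c i r *: cfield A q (e_ i) r.
have sF i : smooth_vfield A W' (fun r => c i r *: cfield A q (e_ i) r).
  apply: smooth_vfieldZ => //; first exact: sX.
  by apply: smooth_vfield_sub (smooth_cfield q (e_ i)) => r [].
have LS s : L (S s) = 0.
  elim: s => [|a s IH].
    by rewrite -[RHS]L0; congr L; apply/funext => r; rewrite /S big_nil.
  have -> : S (a :: s) = fun r => c a r *: cfield A q (e_ a) r + S s r.
    by apply/funext => r; rewrite /S big_cons.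
  rewrite (LD oV Vq VU (sF a) (smooth_vfield_sum s oV sF)).
  rewrite IH addr0 (LZ oV)//; first by rewrite /c /vder Xq tder_v0 scale0r.
    exact: sX.
  by apply: smooth_vfield_sub (smooth_cfield q (e_ a)) => r [].
pose Z r := X r - S (index_enum 'I_d) r.
have Z0 r : W' r -> Z r = 0.
  move=> [Ur qr]; apply/eqP; rewrite subr_eq0; apply/eqP.
  by rewrite {1}(coordinate_decomp (X r) qr).
have -> : X = fun r => Z r + S (index_enum 'I_d) r.
  by apply/funext => r; rewrite subrK.
have sZ : smooth_vfield A W' Z.
  by apply: smooth_vfield_eq (smooth_vfield0 W') => // r Vr; rewrite Z0.
rewrite (LD oV Vq VU sZ (smooth_vfield_sum (index_enum 'I_d) oV sF)).
by rewrite LS addr0 (tensorial_germ oV).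
Qed.

Lemma tensorial V X Y : open V -> V q -> V `<=` U ->
  smooth_vfield A V X -> smooth_vfield A V Y -> X q = Y q -> L X = L Y.
Proof.
move=> oV Vq VU sX sY XY.
have sN : smooth_vfield A V (fun r => Y r - X r) by exact: smooth_vfieldB.
have -> : Y = fun r => X r + (Y r - X r) by apply/funext => r; rewrite addrC subrK.
by rewrite (LD oV)// (tensorial0 oV Vq VU sN) ?addr0// XY subrr.
Qed.

(** Tensors are evaluated at a point by extending vectors with constant
    coordinates; the result is the value on any smooth extension. *)
Lemma tensorial_cfield V X : open V -> V q -> V `<=` U -> smooth_vfield A V X ->
  L (cfield A q (X q)) = L X.
Proof.
move=> oV Vq VU sX; apply: (@tensorial (V `&` dom A q)).
- by apply: openI => //; exact: dom_open.
- by split=> //; exact: dom_mem.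
- by move=> r [/VU].
- by apply: smooth_vfield_sub (smooth_cfield q (X q)) => r [].
- by apply: smooth_vfield_sub sX => r [].
- by rewrite cfield_self.
Qed.

Lemma tensorial_linear : linear (fun x => L (cfield A q x)).
Proof.
pose V := U `&` dom A q.
have oV : open V by apply: openI => //; exact: dom_open.
have Vq : V q by split=> //; exact: dom_mem.
have VU : V `<=` U by move=> r [].
have sC x : smooth_vfield A V (cfield A q x).
  by apply: smooth_vfield_sub (smooth_cfield q x) => r [].
have sc a : smooth_fun A V (fun=> a) by exact: smooth_fun_cst.
have sZ a x : smooth_vfield A V (fun r => a *: cfield A q x r) by exact: smooth_vfieldZ.
move=> a x y; rewrite -(LZ oV Vq VU (sc a) (sC x)) -(LD oV)//.
apply: (tensorial oV) => //; first exact: smooth_vfieldD.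
by rewrite !cfield_self.
Qed.
End tensorial.

End vector_fields.

(** * Orthogonal projections at a point *)

Section pairing.
Context {R : realType} {d : nat}.
Implicit Types x y z a b : 'rV[R]_d.

Lemma pairingDr a x y : pairing a (x + y) = pairing a x + pairing a y.
Proof. by rewrite /pairing linearD /= mulmxDr mxE. Qed.

Lemma pairingZr a c x : pairing a (c *: x) = c * pairing a x.
Proof. by rewrite /pairing linearZ /= -scalemxAr mxE. Qed.

Lemma pairingDl a b x : pairing (a + b) x = pairing a x + pairing b x.
Proof. by rewrite /pairing mulmxDl mxE. Qed.

Lemma pairingZl c a x : pairing (c *: a) x = c * pairing a x.
Proof. by rewrite /pairing -scalemxAl mxE. Qed.

Lemma pairingNl a x : pairing (- a) x = - pairing a x.
Proof. by rewrite -scaleN1r pairingZl mulN1r. Qed.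

Lemma pairing0r a : pairing a 0 = 0.
Proof. by rewrite -(scale0r 0) pairingZr mul0r. Qed.

Lemma pairing_sumr a (I : Type) (r : seq I) (F : I -> 'rV[R]_d) :
  pairing a (\sum_(i <- r) F i) = \sum_(i <- r) pairing a (F i).
Proof.
by elim: r => [|i r IH]; rewrite ?big_nil ?pairing0r// !big_cons pairingDr IH.
Qed.

End pairing.

Section pointwise.
Context {R : realType} {d : nat} {M : topologicalType}.
Variables (g V : M -> 'M[R]_d) (p : M).
Hypothesis gT : (g p)^T = g p.
Hypothesis gpos : forall x : 'rV[R]_d, x != 0 -> 0 < gip g p x x.
Local Notation ip := (gip g p).
Local Notation H := (hspace g V p).
Local Notation hpr := (hpr g V p).
Local Notation vpr := (vpr g V p).
Local Notation sharp := (sharp g p).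
Implicit Types x y z a b : 'rV[R]_d.

Lemma trmx11 (B : 'M[R]_1) : B^T = B.
Proof. by apply/matrixP => i j; rewrite !ord1 mxE. Qed.

Lemma gipC x y : ip x y = ip y x.
Proof. by rewrite /gip -[y *m _ *m _]trmx11 !trmx_mul trmxK gT mulmxA. Qed.

Lemma gipDl x y z : ip (x + y) z = ip x z + ip y z.
Proof. by rewrite /gip !mulmxDl mxE. Qed.

Lemma gipZl c x z : ip (c *: x) z = c * ip x z.
Proof. by rewrite /gip -!scalemxAl mxE. Qed.

Lemma gipDr z x y : ip z (x + y) = ip z x + ip z y.
Proof. by rewrite !(gipC z) gipDl. Qed.

Lemma gipZr c z x : ip z (c *: x) = c * ip z x.
Proof. by rewrite !(gipC z) gipZl. Qed.

Lemma gip0l z : ip 0 z = 0.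
Proof. by rewrite /gip !mul0mx mxE. Qed.

Lemma gip0r z : ip z 0 = 0.
Proof. by rewrite gipC gip0l. Qed.

Lemma gipNl x z : ip (- x) z = - ip x z.
Proof. by rewrite -scaleN1r gipZl mulN1r. Qed.

Lemma gipNr z x : ip z (- x) = - ip z x.
Proof. by rewrite -scaleN1r gipZr mulN1r. Qed.

Lemma gip_eq0 x : ip x x = 0 -> x = 0.
Proof. by move=> x0; apply/eqP/negPn/negP => /gpos; rewrite x0 ltxx. Qed.

Lemma gip_inj x y : (forall z, ip x z = ip y z) -> x = y.
Proof.
move=> xy; apply/eqP; rewrite -subr_eq0; apply/eqP/gip_eq0.
by rewrite gipDl gipNl xy subrr.
Qed.

Lemma metric_unit : g p \in unitmx.
Proof.
rewrite -row_free_unit -kermx_eq0; apply/eqP/row_matrixP => i; rewrite row0.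
apply: gip_eq0; rewrite /gip.
have /sub_kermxP -> := row_sub i (kermx (g p)).
by rewrite mul0mx mxE.
Qed.

Lemma hspaceP x : reflect (forall v, (v <= V p)%MS -> ip x v = 0) (x <= H)%MS.
Proof.
apply: (iffP sub_kermxP) => [xH v /submxP[w ->]|xH].
  by rewrite /gip trmx_mul mulmxA -(mulmxA x) xH mul0mx mxE.
rewrite mulmxA; apply/rowP => j; rewrite mxE [RHS]mxE.
have := xH _ (row_sub j (V p)); rewrite /gip mxE => E; rewrite -[RHS]E.
by apply: eq_bigr => k _; rewrite !mxE.
Qed.

Lemma cap_ver_hor : (V p :&: H)%MS = 0.
Proof.
apply/row_matrixP => i; rewrite row0; apply: gip_eq0.
have := row_sub i (V p :&: H)%MS; rewrite sub_capmx => /andP[iV /hspaceP iH].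
exact: iH.
Qed.

(** The horizontal space is the kernel of [x |-> g(x, .)] restricted to the
    vertical space, so its dimension is complementary; positivity makes the
    intersection trivial. *)
Lemma ver_hor_full : row_full (V p + H)%MS.
Proof.
rewrite -col_leq_rank.
have -> : \rank (V p + H)%MS = (\rank (V p) + \rank H)%N.
  by have := mxrank_sum_cap (V p) H; rewrite cap_ver_hor mxrank0 addn0.
rewrite mxrank_ker -[\rank (_ *m _)]mxrank_tr trmx_mul trmxK gT.
rewrite mxrankMfree ?row_free_unit ?metric_unit// subnKC//.
exact: rank_leq_row.
Qed.

Lemma sub_ver_hor x : (x <= V p + H)%MS.
Proof. exact: submx_full ver_hor_full. Qed.

Lemma sub_hor_ver x : (x <= H + V p)%MS.
Proof. by rewrite addsmxC sub_ver_hor. Qed.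

Lemma cap_hor_ver : (H :&: V p)%MS = 0.
Proof. by rewrite capmxC cap_ver_hor. Qed.

Lemma hpr_sub x : (x *m hpr <= H)%MS.
Proof. exact: proj_mx_sub. Qed.

Lemma vpr_sub x : (x *m vpr <= V p)%MS.
Proof. exact: proj_mx_sub. Qed.

Lemma hv_split x : x = x *m hpr + x *m vpr.
Proof. by rewrite add_proj_mx ?sub_hor_ver ?cap_hor_ver. Qed.

Lemma hpr_id x : (x <= H)%MS -> x *m hpr = x.
Proof. by move=> xH; rewrite proj_mx_id ?cap_hor_ver. Qed.

Lemma vpr_id x : (x <= V p)%MS -> x *m vpr = x.
Proof. by move=> xH; rewrite proj_mx_id ?cap_ver_hor. Qed.

Lemma hpr_0 x : (x <= V p)%MS -> x *m hpr = 0.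
Proof. by move=> xH; rewrite proj_mx_0 ?cap_hor_ver. Qed.

Lemma vpr_0 x : (x <= H)%MS -> x *m vpr = 0.
Proof. by move=> xH; rewrite proj_mx_0 ?cap_ver_hor. Qed.

Lemma hpr_uniq x y : (y <= H)%MS -> (x - y <= V p)%MS -> x *m hpr = y.
Proof.
by move=> yH xyV; rewrite -[x](subrK y) mulmxDl hpr_0// hpr_id// add0r.
Qed.

Lemma gip_orth x y : (x <= H)%MS -> (y <= V p)%MS -> ip x y = 0.
Proof. by move=> /hspaceP xH yV; exact: xH. Qed.

Lemma gip_orthC x y : (x <= V p)%MS -> (y <= H)%MS -> ip x y = 0.
Proof. by move=> yV xH; rewrite gipC gip_orth. Qed.

Lemma gip_hl x y : ip (x *m hpr) y = ip (x *m hpr) (y *m hpr).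
Proof. by rewrite {1}(hv_split y) gipDr (gip_orth (hpr_sub x) (vpr_sub y)) addr0. Qed.

Lemma gip_hr x y : ip x (y *m hpr) = ip (x *m hpr) (y *m hpr).
Proof. by rewrite gipC gip_hl gipC. Qed.

Lemma gip_vl x y : ip (x *m vpr) y = ip (x *m vpr) (y *m vpr).
Proof. by rewrite {1}(hv_split y) gipDr (gip_orthC (vpr_sub x) (hpr_sub y)) add0r. Qed.

Lemma gip_vr x y : ip x (y *m vpr) = ip (x *m vpr) (y *m vpr).
Proof. by rewrite gipC gip_vl gipC. Qed.

Lemma gip_sharp a y : ip (sharp a) y = pairing a y.
Proof. by rewrite /gip /sharp mulmxKV// metric_unit. Qed.

Lemma gip_suml (I : Type) (r : seq I) (F : I -> 'rV[R]_d) y :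
  ip (\sum_(i <- r) F i) y = \sum_(i <- r) ip (F i) y.
Proof.
by elim: r => [|i r IH]; rewrite ?big_nil ?gip0l// !big_cons gipDl IH.
Qed.

Lemma gip_sumr (I : Type) (r : seq I) (F : I -> 'rV[R]_d) y :
  ip y (\sum_(i <- r) F i) = \sum_(i <- r) ip y (F i).
Proof. by rewrite gipC gip_suml; apply: eq_bigr => i _; rewrite gipC. Qed.

Lemma sharp_uniq a x : (forall y, ip x y = pairing a y) -> sharp a = x.
Proof. by move=> xa; apply: gip_inj => z; rewrite gip_sharp xa. Qed.

Lemma inv_metric_sym : (invmx (g p))^T = invmx (g p).
Proof. by rewrite trmx_inv gT. Qed.

Lemma cogipE a b : cogip g p a b = ip (sharp a) (sharp b).
Proof. by rewrite gip_sharp /cogip /pairing /sharp trmx_mul inv_metric_sym mulmxA. Qed.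

(** The projections are self-adjoint, so that raising indices intertwines them
    with their duals. *)
Lemma sharp_h a : sharp (a *m hpr^T) = sharp a *m hpr.
Proof.
apply: sharp_uniq => y; rewrite gip_hl -gip_hr gip_sharp.
by rewrite /pairing trmx_mul mulmxA.
Qed.

Lemma sharp_v a : sharp (a *m vpr^T) = sharp a *m vpr.
Proof.
apply: sharp_uniq => y; rewrite gip_vl -gip_vr gip_sharp.
by rewrite /pairing trmx_mul mulmxA.
Qed.

(** The vertical space is now the kernel of a surjective map [x |-> x *m F];
    the rows of [F^T g^-1] are the gradients of its components. They span the
    horizontal space, so that the projection is computed from their Gram
    matrix; this formula makes the projection smooth in the point. *)
Section submersion.
Variables (n : nat) (F : 'M[R]_(d, n)).
Hypothesis FV : forall x, (x <= V p)%MS <-> x *m F = 0.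
Hypothesis Fsurj : forall w : 'rV[R]_n, exists x, x *m F = w.
Local Notation N := (F^T *m invmx (g p) *m F).

Lemma gram_unit : N \in unitmx.
Proof.
suff key (w : 'rV_n) : w *m N = 0 -> w = 0.
  rewrite -row_free_unit -kermx_eq0; apply/eqP/row_matrixP => i; rewrite row0.
  by apply: key; apply/sub_kermxP; exact: row_sub.
move=> wN.
have w0 : w *m F^T *m invmx (g p) = 0.
  apply: gip_eq0; rewrite /gip !trmx_mul trmxK inv_metric_sym mulmxKV ?metric_unit//.
  have -> : w *m F^T *m (invmx (g p) *m (F *m w^T)) = w *m N *m w^T by rewrite !mulmxA.
  by rewrite wN mul0mx mxE.
have {w0} wF : w *m F^T = 0.
  by rewrite -[w *m F^T](mulmxK metric_unit) -[LHS]mulmxA -(mulmxKV metric_unit (w *m F^T)) w0 mul0mx mul0mx.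
have [x xw] := Fsurj w.
have : w *m w^T = 0 by rewrite -{2}xw trmx_mul mulmxA wF mul0mx.
move=> /matrixP/(_ 0 0); rewrite !mxE => ww.
apply/rowP => j; rewrite [RHS]mxE; apply/eqP; rewrite -sqrf_eq0.
have := ww; rewrite (bigD1 j)//= mxE => /eqP; rewrite paddr_eq0.
- by move=> /andP[]; rewrite -expr2.
- by rewrite -expr2 sqr_ge0.
- by apply: sumr_ge0 => k _; rewrite mxE -expr2 sqr_ge0.
Qed.

Lemma hpr_submersion x : x *m hpr = x *m F *m invmx N *m (F^T *m invmx (g p)).
Proof.
apply: hpr_uniq.
  apply/hspaceP => v /FV vF; rewrite /gip mulmxA mulmxKV ?metric_unit//.
  by rewrite -mulmxA -trmx_mul vF trmx0 mulmx0 mxE.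
apply/FV; rewrite mulmxBl -!mulmxA [_ *m (invmx _ *m F)]mulmxA.
by rewrite mulVmx ?gram_unit// mulmx1 subrr.
Qed.
End submersion.

End pointwise.

Section pointwise_forms.
Context {R : realType} {n m : nat} {M : topologicalType}.
Variables (g V : M -> 'M[R]_(n + m)) (p : M).
Hypothesis gT : (g p)^T = g p.
Hypothesis gpos : forall x : 'rV[R]_(n + m), x != 0 -> 0 < gip g p x x.
Implicit Types a b : 'rV[R]_(n + m).

Lemma pairing_covec (f : 'rV[R]_(n + m) -> R) x : linear (f : _ -> R^o) ->
  pairing (covec f) x = f x.
Proof.
move=> lf; pose fl : {linear 'rV[R]_(n + m) -> R^o} := HB.pack (f : _ -> R^o) (GRing.isLinear.Build _ _ _ _ _ lf).
rewrite {2}[x]row_sum_delta [RHS](linear_sum fl) /pairing mxE.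
by apply: eq_bigr => i _; rewrite [RHS]linearZ !mxE mulrC.
Qed.

Lemma mul_endo (f : 'rV[R]_(n + m) -> 'rV[R]_(n + m)) x : linear f -> x *m endo f = f x.
Proof.
move=> lf; pose fl : {linear 'rV[R]_(n + m) -> 'rV[R]_(n + m)} := HB.pack f (GRing.isLinear.Build _ _ _ _ _ lf).
rewrite {2}[x]row_sum_delta [RHS](linear_sum fl) mulmx_sum_row.
by apply: eq_bigr => i _; rewrite [RHS]linearZ rowK.
Qed.

Lemma ip_hE a b : ip_h g V p a b = pairing a (sharp g p b *m hpr g V p).
Proof. by rewrite /ip_h cogipE// !sharp_h// -gip_hr// gip_sharp. Qed.

Lemma ip_vE a b : ip_v g V p a b = pairing a (sharp g p b *m vpr g V p).
Proof. by rewrite /ip_v cogipE// !sharp_v// -gip_vr// gip_sharp. Qed.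

End pointwise_forms.

(** * Smoothness of metric constructions and of the horizontal projection *)

Section smoothness.
Context {R : realType} {d : nat} {M : topologicalType} (A : atlas R d M).
Implicit Types (U W : set M) (f h : M -> R) (X Y : vfield R d M).
Local Notation e_ i := (delta_mx 0 i : 'rV[R]_d).

Lemma smooth_det U k (B : M -> 'M[R]_k) : open U ->
  (forall i j, smooth_fun A U (fun q => B q i j)) -> smooth_fun A U (fun q => \det (B q)).
Proof.
move=> oU sB; apply: smooth_fun_sum => // s; apply: smooth_funM => //.
  exact: smooth_fun_cst.
by apply: smooth_fun_prod.
Qed.

Lemma smooth_invmx U k (B : M -> 'M[R]_k) : open U ->
  (forall q, U q -> B q \in unitmx) ->
  (forall i j, smooth_fun A U (fun q => B q i j)) ->
  forall i j, smooth_fun A U (fun q => invmx (B q) i j).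
Proof.
move=> oU uB sB i j.
apply: (@smooth_fun_eq _ _ _ _ _ (fun q => (\det (B q))^-1 *
   ((-1) ^+ (j + i) * \det (row' j (col' i (B q)))))) => //.
  by move=> q Uq; rewrite /invmx uB// !mxE.
apply: smooth_funM => //.
  apply: smooth_funV => //; last exact: smooth_det.
  by move=> q /uB; rewrite unitmxE unitfE.
apply: smooth_funM => //; first exact: smooth_fun_cst.
apply: smooth_det => // i' j'; apply: smooth_fun_eq (sB (lift j i') (lift i j')) => //.
by move=> q _; rewrite !mxE.
Qed.

(** The rows are the coordinate fields of the chart at [a]; they carry all
    matrices from the moving charts in which tangent vectors are stored to one
    fixed chart. *)
Definition cframe a q : 'M[R]_d := \matrix_i cfield A a (e_ i) q.

Lemma cframe_decomp a q v : dom A a q ->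
  v = (\row_i tder A q v (fun r => phi A a r 0 i)) *m cframe a q.
Proof.
move=> aq; rewrite {1}(coordinate_decomp v aq) mulmx_sum_row.
by apply: eq_bigr => i _; rewrite rowK mxE.
Qed.

Lemma cframe_unit a q : dom A a q -> cframe a q \in unitmx.
Proof.
move=> aq; pose K : 'M[R]_d := \matrix_k (\row_i tder A q (e_ k) (fun r => phi A a r 0 i)).
have KJ : K *m cframe a q = 1%:M.
  by apply/row_matrixP => k; rewrite row_mul rowK -cframe_decomp// row1.
by have [] := mulmx1_unit KJ.
Qed.

Section metric.
Variable g : M -> 'M[R]_d.
Hypothesis g_metric : riemannian_metric A g.

Lemma metric_sym p : (g p)^T = g p. Proof. by have [] := g_metric. Qed.
Lemma metric_pos p (x : 'rV[R]_d) : x != 0 -> 0 < gip g p x x.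
Proof. by have [_ h _] := g_metric; exact: h. Qed.
Local Hint Resolve metric_sym metric_pos : core.

Definition cgram a q : 'M[R]_d := cframe a q *m g q *m (cframe a q)^T.

Lemma cgramE a q i j : cgram a q i j =
  gip g q (cfield A a (e_ i) q) (cfield A a (e_ j) q).
Proof.
rewrite /gip -[in RHS](rowK (fun i => cfield A a (e_ i) q) i).
rewrite -[in RHS](rowK (fun i => cfield A a (e_ i) q) j) -/(cframe a q).
rewrite -row_mul [LHS]mxE [RHS]mxE; apply: eq_bigr => k _.
by rewrite [in RHS]mxE; congr (_ * _); rewrite !mxE.
Qed.

Lemma cgram_smooth a i j : smooth_fun A (dom A a) (fun q => cgram a q i j).
Proof.
have [_ _ sg] := g_metric; apply: smooth_fun_eq (sg a i j); first exact: dom_open.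
by move=> q _; rewrite cgramE.
Qed.

Lemma cgram_unit a q : dom A a q -> cgram a q \in unitmx.
Proof.
by move=> aq; rewrite !unitmx_mul unitmx_tr cframe_unit// (metric_unit (@metric_pos q)).
Qed.

Lemma smooth_gip U X Y : open U -> smooth_vfield A U X -> smooth_vfield A U Y ->
  smooth_fun A U (fun q => gip g q (X q) (Y q)).
Proof.
move=> oU sX sY; apply: smooth_fun_local => a Ua; exists (U `&` dom A a).
  by split=> //; exact: dom_mem.
have oUa : open (U `&` dom A a) by apply: openI => //; exact: dom_open.
apply: (@smooth_fun_eq _ _ _ _ _ (fun q => \sum_i \sum_j
  vder A X (fun r => phi A a r 0 i) q * vder A Y (fun r => phi A a r 0 j) q * cgram a q i j)) => //.
  move=> q [Uq aq]; rewrite [in RHS](coordinate_decomp (X q) aq) [in RHS](coordinate_decomp (Y q) aq).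
  rewrite gip_suml//; apply: eq_bigr => i _; rewrite gip_sumr//.
  by apply: eq_bigr => j _; rewrite cgramE gipZr// gipZl// mulrCA mulrA.
apply: smooth_fun_sum => // i; apply: smooth_fun_sum => // j.
apply: smooth_funM => //; first exact: smooth_funM (sX a i) (sY a j).
by apply: smooth_fun_sub (cgram_smooth a i j) => q [].
Qed.

Lemma smooth_pairing U eta X : open U -> smooth_form A U eta -> smooth_vfield A U X ->
  smooth_fun A U (fun q => pairing (eta q) (X q)).
Proof.
move=> oU se sX; apply: smooth_fun_local => a Ua; exists (U `&` dom A a).
  by split=> //; exact: dom_mem.
have oUa : open (U `&` dom A a) by apply: openI => //; exact: dom_open.
apply: (@smooth_fun_eq _ _ _ _ _ (fun q => \sum_i
  vder A X (fun r => phi A a r 0 i) q * pairing (eta q) (cfield A a (e_ i) q))) => //.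
  move=> q [Uq aq]; rewrite [in RHS](coordinate_decomp (X q) aq).
  by rewrite pairing_sumr; apply: eq_bigr => i _; rewrite pairingZr.
by apply: smooth_fun_sum => // i; exact: smooth_funM (sX a i) (se a i).
Qed.

(** In the frame of a fixed chart, raising an index is multiplication by the
    inverse of the Gram matrix of the frame. *)
Lemma smooth_sharp U eta : open U -> smooth_form A U eta ->
  smooth_vfield A U (fun q => sharp g q (eta q)).
Proof.
move=> oU se; apply: smooth_vfield_local => a Ua; exists (U `&` dom A a).
  by split=> //; exact: dom_mem.
have oUa : open (U `&` dom A a) by apply: openI => //; exact: dom_open.
apply: (@smooth_vfield_eq _ _ _ _ _ (fun q => \sum_j
  (\sum_i pairing (eta q) (cfield A a (e_ i) q) * invmx (cgram a q) i j) *: cfield A a (e_ j) q)) => //.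
  move=> q [Uq aq].
  have -> : sharp g q (eta q) = (eta q *m (cframe a q)^T) *m invmx (cgram a q) *m cframe a q.
    apply: (sharp_uniq (@metric_pos q)) => y; rewrite (cframe_decomp y aq).
    set c := \row_i _; rewrite /gip /pairing trmx_mul.
    rewrite -(mulmxA _ (cframe a q)) !mulmxA -(mulmxA _ _ (g q)).
    have -> : eta q *m (cframe a q)^T *m invmx (cgram a q) *m (cframe a q *m g q) *m (cframe a q)^T
      = eta q *m (cframe a q)^T *m (invmx (cgram a q) *m cgram a q) by rewrite /cgram !mulmxA.
    by rewrite mulVmx ?cgram_unit// mulmx1.
  rewrite mulmx_sum_row; apply: eq_bigr => j _; rewrite rowK; congr (_ *: _).
  rewrite mxE; apply: eq_bigr => i _; congr (_ * _).
  by rewrite /pairing !mxE; apply: eq_bigr => k _; rewrite !mxE.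
apply: smooth_vfield_sum => // j; apply: smooth_vfieldZ => //.
  apply: smooth_fun_sum => // i; apply: smooth_funM => //.
  apply: smooth_invmx => //; first by move=> q [_ aq]; exact: cgram_unit.
  by move=> i' j'; apply: smooth_fun_sub (cgram_smooth a i' j') => q [].
by apply: smooth_vfield_sub (smooth_cfield A a (e_ j)) => q [].
Qed.


Section foliation.
Variable V : M -> 'M[R]_d.

Section submersion.
Variables (n : nat) (U : set M) (f : M -> 'rV[R]_n).
Hypothesis oU : open U.
Local Notation comp i := (fun q => f q 0 i).
Hypothesis smooth_comp : forall i, smooth_fun A U (comp i).
Local Notation df q x := (\row_i tder A q x (comp i)).
Hypothesis df_surj : forall q, U q -> forall w, exists x, df q x = w.
Hypothesis df_ker : forall q, U q -> forall x, (x <= V q)%MS <-> df q x = 0.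

Definition differential q : 'M[R]_(d, n) := \matrix_(k, i) tder A q (e_ k) (comp i).
Definition comp_differential i : oneform R d M := fun q => (col i (differential q))^T.
Definition comp_gradient i : vfield R d M := fun q => sharp g q (comp_differential i q).

Lemma differentialE q x : U q -> x *m differential q = \row_i tder A q x (comp i).
Proof.
move=> Uq; apply/rowP => i; rewrite !mxE {2}[x]row_sum_delta.
rewrite (tder_vsum _ _ oU (smooth_comp i) Uq); apply: eq_bigr => k _.
by rewrite (tder_vZ _ _ oU (smooth_comp i) Uq) mxE.
Qed.

Lemma comp_differentialE i q x : U q -> pairing (comp_differential i q) x = tder A q x (comp i).
Proof.
move=> Uq; rewrite /pairing /comp_differential -trmx_mul trmx11 colE mulmxA -colE.
by rewrite differentialE// !mxE.
Qed.

Lemma smooth_comp_differential i : smooth_form A U (comp_differential i).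
Proof.
move=> a k; have oUa : open (U `&` dom A a) by apply: openI => //; exact: dom_open.
apply: (@smooth_fun_eq _ _ _ _ _ (vder A (cfield A a (e_ k)) (comp i))) => //.
  by move=> q [Uq aq]; rewrite comp_differentialE.
apply: vder_smooth => //; first by apply: smooth_vfield_sub (smooth_cfield A a (e_ k)) => q [].
by apply: smooth_fun_sub (smooth_comp i) => q [].
Qed.

Lemma smooth_comp_gradient i : smooth_vfield A U (comp_gradient i).
Proof. exact: smooth_sharp (smooth_comp_differential i). Qed.

Lemma comp_gradient_row i q : row i ((differential q)^T *m invmx (g q)) = comp_gradient i q.
Proof. by rewrite row_mul -tr_col. Qed.

Lemma differential_kernel q (x : 'rV[R]_d) : U q -> (x <= V q)%MS <-> x *m differential q = 0.
Proof. by move=> Uq; rewrite differentialE//; exact: df_ker. Qed.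

Lemma differential_surj q w : U q -> exists x : 'rV[R]_d, x *m differential q = w.
Proof. by move=> Uq; have [x xw] := df_surj Uq w; exists x; rewrite differentialE. Qed.

Lemma smooth_hpr_submersion X : smooth_vfield A U X ->
  smooth_vfield A U (fun q => X q *m hpr g V q).
Proof.
move=> sX; pose N q := (differential q)^T *m invmx (g q) *m differential q.
have sN i j : smooth_fun A U (fun q => N q i j).
  have := vder_smooth oU (smooth_comp_gradient i) (smooth_comp j).
  apply: smooth_fun_eq => // q Uq.
  have -> : N q i j = row i (N q) 0 j by rewrite [RHS]mxE.
  by rewrite row_mul comp_gradient_row differentialE// mxE.
apply: (@smooth_vfield_eq _ _ _ _ _ (fun q => \sum_j
    (\sum_i vder A X (comp i) q * invmx (N q) i j) *: comp_gradient j q)) => //.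
  move=> q Uq; rewrite (hpr_submersion (metric_sym q) (@metric_pos q)
    (fun x => differential_kernel x Uq) (fun w => differential_surj w Uq)).
  rewrite mulmx_sum_row; apply: eq_bigr => j _; rewrite comp_gradient_row; congr (_ *: _).
  by rewrite differentialE// mxE; apply: eq_bigr => i _; rewrite mxE.
apply: (smooth_vfield_sum _ oU) => j; apply: (smooth_vfieldZ oU _ (smooth_comp_gradient j)).
apply: (smooth_fun_sum _ _ oU) => i; apply: (smooth_funM oU (vder_smooth oU sX (smooth_comp i))).
apply: (smooth_invmx oU) => // q Uq.
exact: (gram_unit (metric_sym q) (@metric_pos q) (fun w => differential_surj w Uq)).
Qed.
End submersion.

Variable n : nat.
Hypothesis V_fol : riemannian_foliation A g V n.

Lemma smooth_hpr U X : open U -> smooth_vfield A U X ->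
  smooth_vfield A U (fun q => X q *m hpr g V q).
Proof.
move=> oU sX; apply: smooth_vfield_local => p Up.
have [W [f [b [oW Wp [_ sf sj kV _]]]]] := V_fol p.
have oUW : open (U `&` W) by exact: openI.
exists (U `&` W) => //; apply: (@smooth_hpr_submersion n _ f oUW).
- by move=> i; apply: smooth_fun_sub (sf i) => q [].
- by move=> q [_ Wq]; exact: sj.
- by move=> q [_ Wq]; exact: kV.
- by apply: smooth_vfield_sub sX => q [].
Qed.

Lemma smooth_vpr U X : open U -> smooth_vfield A U X ->
  smooth_vfield A U (fun q => X q *m vpr g V q).
Proof.
move=> oU sX; apply: smooth_vfield_eq (smooth_vfieldB oU sX (smooth_hpr oU sX)) => //.
move=> q _; rewrite {1}(hv_split V (metric_sym q) (@metric_pos q) (X q)).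
by rewrite addrC addKr.
Qed.

End foliation.
End metric.
End smoothness.

(* The bracket is used only through [lc_lie], the other notions only through
   the lemmas above. *)
#[local] Opaque lie smooth_fun smooth_vfield hpr vpr.

(** * Consequences of the axioms of the Levi-Civita connection *)

Section levi_civita_calculus.
Context {R : realType} {d : nat} {M : topologicalType} (A : atlas R d M).
Variables (g : M -> 'M[R]_d) (D : vfield R d M -> vfield R d M -> vfield R d M).
Hypothesis D_lc : levi_civita A g D.
Implicit Types (U W : set M) (f h : M -> R) (X Y Z : vfield R d M).
Local Notation svf := (smooth_vfield A).

Lemma lc_smooth U X Y : open U -> svf U X -> svf U Y -> svf U (D X Y).
Proof. by move=> oU sX sY; have [] := D_lc oU sX sY. Qed.

Lemma lc_Dl U X X' Y p : open U -> svf U X -> svf U X' -> svf U Y -> U p ->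
  D (fun q => X q + X' q) Y p = D X Y p + D X' Y p.
Proof. by move=> oU sX sX' sY Up; have [_ h _ _ _] := D_lc oU sX sY; exact: h. Qed.

Lemma lc_Dr U X Y Y' p : open U -> svf U X -> svf U Y -> svf U Y' -> U p ->
  D X (fun q => Y q + Y' q) p = D X Y p + D X Y' p.
Proof. by move=> oU sX sY sY' Up; have [_ _ h _ _] := D_lc oU sX sY; exact: h. Qed.

Lemma lc_Zl U f X Y p : open U -> smooth_fun A U f -> svf U X -> svf U Y -> U p ->
  D (fun q => f q *: X q) Y p = f p *: D X Y p.
Proof.
by move=> oU sf sX sY Up; have [_ _ _ h _] := D_lc oU sX sY; have [] := h f sf p Up.
Qed.

Lemma lc_Zr U f X Y p : open U -> smooth_fun A U f -> svf U X -> svf U Y -> U p ->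
  D X (fun q => f q *: Y q) p = vder A X f p *: Y p + f p *: D X Y p.
Proof.
by move=> oU sf sX sY Up; have [_ _ _ h _] := D_lc oU sX sY; have [] := h f sf p Up.
Qed.

Lemma lc_lie U X Y p : open U -> svf U X -> svf U Y -> U p ->
  lie A X Y p = D X Y p - D Y X p.
Proof. by move=> oU sX sY Up; have [_ _ _ _ [h _]] := D_lc oU sX sY; rewrite h. Qed.

Lemma lc_metric U X Y Z p : open U -> svf U X -> svf U Y -> svf U Z -> U p ->
  vder A X (fun q => gip g q (Y q) (Z q)) p
  = gip g p (D X Y p) (Z p) + gip g p (Y p) (D X Z p).
Proof.
by move=> oU sX sY sZ Up; have [_ _ _ _ [_ h]] := D_lc oU sX sY; exact: h.
Qed.

Lemma lc_tensorial U X X' Y p : open U -> svf U X -> svf U X' -> svf U Y -> U p ->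
  X p = X' p -> D X Y p = D X' Y p.
Proof.
move=> oU sX sX' sY Up; have sub W (WU : W `<=` U) := smooth_vfield_sub WU sY.
apply: (@tensorial _ _ _ A _ (fun X => D X Y p) p U _ _ U) => //.
- by move=> W Z Z' oW Wp WU sZ sZ'; exact: (lc_Dl oW sZ sZ' (sub W WU) Wp).
- by move=> W f Z oW Wp WU sf sZ; exact: (lc_Zl oW sf sZ (sub W WU) Wp).
Qed.

(** Locality in the differentiated field, by the product rule with the
    indicator of the complement of [U]. *)
Lemma lc_0r U X Y p : open U -> svf U X -> U p -> (forall q, U q -> Y q = 0) ->
  D X Y p = 0.
Proof.
move=> oU sX Up Y0; pose c r : R := if `[< U r >] then 0 else 1.
have sY : svf U Y.
  by apply: smooth_vfield_eq (smooth_vfield0 A U) => // q Uq; rewrite Y0.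
have c0 q : U q -> 0 = c q by move=> Uq; rewrite /c asboolT.
have sc : smooth_fun A U c by apply: smooth_fun_eq (smooth_fun_cst A U 0).
have -> : Y = fun q => c q *: Y q.
  apply/funext => q; rewrite /c; case: asboolP => Uq; last by rewrite scale1r.
  by rewrite Y0// scaler0.
by rewrite (lc_Zr oU sc sX sY Up) -c0// Y0// scaler0 scale0r addr0.
Qed.

Lemma lc_eqr U X Y Y' p : open U -> svf U X -> svf U Y -> svf U Y' -> U p ->
  (forall q, U q -> Y q = Y' q) -> D X Y p = D X Y' p.
Proof.
move=> oU sX sY sY' Up YY'.
have -> : Y' = fun q => Y q + (Y' q - Y q) by apply/funext => q; rewrite addrC subrK.
rewrite (lc_Dr oU sX sY (smooth_vfieldB oU sY' sY) Up).
rewrite [X in _ + X](lc_0r oU sX Up) ?addr0// => q Uq.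
by rewrite YY'// subrr.
Qed.

Lemma lc_0l U X Y p : open U -> svf U X -> svf U Y -> U p -> X p = 0 -> D X Y p = 0.
Proof.
move=> oU sX sY Up X0; have s0 := smooth_vfield0 A U.
rewrite (lc_tensorial oU sX s0 sY Up X0).
have E : (fun q : M => (0 : R) *: (0 : 'rV[R]_d)) = fun=> 0 by apply/funext => q; rewrite scaler0.
by rewrite -E (lc_Zl oU (smooth_fun_cst A U 0) s0 sY Up) scale0r.
Qed.

(** The bracket is handled as [D X Y - D Y X]: smoothness, bilinearity and the
    product rules then follow from those of [D]. *)
Lemma lie_smooth U X Y : open U -> svf U X -> svf U Y -> svf U (lie A X Y).
Proof.
move=> oU sX sY; have := smooth_vfieldB oU (lc_smooth oU sX sY) (lc_smooth oU sY sX).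
by apply: smooth_vfield_eq => // q Uq; rewrite (lc_lie oU).
Qed.

Lemma lie_Dl U X X' Y p : open U -> svf U X -> svf U X' -> svf U Y -> U p ->
  lie A (fun q => X q + X' q) Y p = lie A X Y p + lie A X' Y p.
Proof.
move=> oU sX sX' sY Up; rewrite (lc_lie oU (smooth_vfieldD oU sX sX') sY Up).
rewrite (lc_lie oU sX sY Up) (lc_lie oU sX' sY Up) (lc_Dl oU sX sX' sY Up).
by rewrite (lc_Dr oU sY sX sX' Up) opprD addrACA.
Qed.

Lemma lieC U X Y p : open U -> svf U X -> svf U Y -> U p -> lie A Y X p = - lie A X Y p.
Proof.
by move=> oU sX sY Up; rewrite (lc_lie oU sX sY Up) (lc_lie oU sY sX Up) opprB.
Qed.

Lemma lie_Dr U X Y Y' p : open U -> svf U X -> svf U Y -> svf U Y' -> U p ->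
  lie A X (fun q => Y q + Y' q) p = lie A X Y p + lie A X Y' p.
Proof.
move=> oU sX sY sY' Up; rewrite (lieC oU (smooth_vfieldD oU sY sY') sX Up).
by rewrite (lie_Dl oU sY sY' sX Up) opprD (lieC oU sY sX Up) (lieC oU sY' sX Up).
Qed.

Lemma lie_Zl U f X Y p : open U -> smooth_fun A U f -> svf U X -> svf U Y -> U p ->
  lie A (fun q => f q *: X q) Y p = f p *: lie A X Y p - vder A Y f p *: X p.
Proof.
move=> oU sf sX sY Up; rewrite (lc_lie oU (smooth_vfieldZ oU sf sX) sY Up).
rewrite (lc_lie oU sX sY Up) (lc_Zl oU sf sX sY Up) (lc_Zr oU sf sY sX Up).
by rewrite scalerBr opprD addrCA addrC.
Qed.

Lemma lie_Zr U f X Y p : open U -> smooth_fun A U f -> svf U X -> svf U Y -> U p ->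
  lie A X (fun q => f q *: Y q) p = vder A X f p *: Y p + f p *: lie A X Y p.
Proof.
move=> oU sf sX sY Up; rewrite (lieC oU (smooth_vfieldZ oU sf sY) sX Up).
rewrite (lie_Zl oU sf sY sX Up) opprB; congr (_ + _).
by rewrite -scalerN -(lieC oU sY sX Up).
Qed.

Lemma lie_0r U X Y p : open U -> svf U X -> svf U Y -> U p -> (forall q, U q -> Y q = 0) ->
  lie A X Y p = 0.
Proof.
move=> oU sX sY Up Y0; rewrite (lc_lie oU sX sY Up) (lc_0r oU sX Up Y0).
by rewrite (lc_0l oU sY sX Up) ?subrr// Y0.
Qed.

Lemma lie_eqr U X Y Y' p : open U -> svf U X -> svf U Y -> svf U Y' -> U p ->
  (forall q, U q -> Y q = Y' q) -> lie A X Y p = lie A X Y' p.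
Proof.
move=> oU sX sY sY' Up YY'; rewrite (lc_lie oU sX sY Up) (lc_lie oU sX sY' Up).
by rewrite (lc_eqr oU sX sY sY' Up YY') (lc_tensorial oU sY sY' sX Up (YY' _ Up)).
Qed.

End levi_civita_calculus.

(** * The Bott connection and its torsion *)

Section bott_calculus.
Context {R : realType} {n m : nat} {M : topologicalType}.
Variables (A : atlas R (n + m) M) (g V : M -> 'M[R]_(n + m)).
Variable D : vfield R (n + m) M -> vfield R (n + m) M -> vfield R (n + m) M.
Hypotheses (g_metric : riemannian_metric A g) (V_fol : riemannian_foliation A g V n).
Hypotheses (D_lc : levi_civita A g D) (V_tg : totally_geodesic_leaves A V D).
Implicit Types (U W : set M) (f h : M -> R) (X Y Z : vfield R (n + m) M).
Implicit Types (alpha beta eta : oneform R (n + m) M).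
Local Notation svf := (smooth_vfield A).
Local Notation hP := (hpart g V).
Local Notation vP := (vpart g V).
Local Notation bott := (bott A g V D).
Local Notation torsion := (torsion A g V D).
Local Notation torsion_at := (torsion_at A g V D).
Local Notation vder := (vder A).
Local Notation ip q := (gip g q).
Local Notation hpr := (hpr g V).
Local Notation vpr := (vpr g V).
Local Notation gsym := (metric_sym g_metric).
Local Notation gpos := (@metric_pos _ _ _ _ _ g_metric _).

Lemma hpartD X Y : hP (fun q => X q + Y q) = fun q => hP X q + hP Y q.
Proof. by apply/funext => q; rewrite /hpart mulmxDl. Qed.
Lemma vpartD X Y : vP (fun q => X q + Y q) = fun q => vP X q + vP Y q.
Proof. by apply/funext => q; rewrite /vpart mulmxDl. Qed.
Lemma hpartZ f X : hP (fun q => f q *: X q) = fun q => f q *: hP X q.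
Proof. by apply/funext => q; rewrite /hpart -scalemxAl. Qed.
Lemma vpartZ f X : vP (fun q => f q *: X q) = fun q => f q *: vP X q.
Proof. by apply/funext => q; rewrite /vpart -scalemxAl. Qed.

Lemma hpr_hor q (x : 'rV[R]_(n + m)) : (x <= hspace g V q)%MS -> x *m hpr q = x.
Proof. by apply: hpr_id => *; exact: gpos. Qed.
Lemma vpr_ver q (x : 'rV[R]_(n + m)) : (x <= V q)%MS -> x *m vpr q = x.
Proof. by apply: vpr_id => *; exact: gpos. Qed.
Lemma hpr_ver q (x : 'rV[R]_(n + m)) : (x <= V q)%MS -> x *m hpr q = 0.
Proof. by apply: hpr_0 => *; exact: gpos. Qed.
Lemma vpr_hor q (x : 'rV[R]_(n + m)) : (x <= hspace g V q)%MS -> x *m vpr q = 0.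
Proof. by apply: vpr_0 => *; exact: gpos. Qed.
Lemma hv_decomp q (x : 'rV[R]_(n + m)) : x = x *m hpr q + x *m vpr q.
Proof. by apply: hv_split => *; [exact: gsym|exact: gpos]. Qed.

Lemma hpr_idem q (x : 'rV[R]_(n + m)) : x *m hpr q *m hpr q = x *m hpr q.
Proof. by rewrite hpr_hor// hpr_sub. Qed.
Lemma vpr_idem q (x : 'rV[R]_(n + m)) : x *m vpr q *m vpr q = x *m vpr q.
Proof. by rewrite vpr_ver// vpr_sub. Qed.
Lemma vpr_hpr q (x : 'rV[R]_(n + m)) : x *m hpr q *m vpr q = 0.
Proof. by rewrite vpr_hor// hpr_sub. Qed.
Lemma hpr_vpr q (x : 'rV[R]_(n + m)) : x *m vpr q *m hpr q = 0.
Proof. by rewrite hpr_ver// vpr_sub. Qed.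

Lemma hvpart X : X = fun q => hP X q + vP X q.
Proof.
by apply/funext => q; rewrite /hpart /vpart -hv_decomp.
Qed.

Lemma hpart_sub X q : (hP X q <= hspace g V q)%MS.
Proof. exact: (hpr_sub). Qed.
Lemma vpart_sub X q : (vP X q <= V q)%MS.
Proof. exact: (vpr_sub). Qed.

Lemma smooth_hpart U X : open U -> svf U X -> svf U (hP X).
Proof. exact: (smooth_hpr g_metric V_fol). Qed.
Lemma smooth_vpart U X : open U -> svf U X -> svf U (vP X).
Proof. exact: (smooth_vpr g_metric V_fol). Qed.

Lemma bott_smooth U X Y : open U -> svf U X -> svf U Y -> svf U (bott X Y).
Proof.
move=> oU sX sY; have hX := smooth_hpart oU sX; have hY := smooth_hpart oU sY.
have vX := smooth_vpart oU sX; have vY := smooth_vpart oU sY.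
rewrite /Defs.bott; apply: (smooth_vfieldD oU); last first.
  exact: (smooth_vpart oU (lc_smooth D_lc oU vX vY)).
apply: (smooth_vfieldD oU); last exact: (smooth_vpart oU (lie_smooth D_lc oU hX vY)).
apply: (smooth_vfieldD oU); last exact: (smooth_hpart oU (lie_smooth D_lc oU vX hY)).
exact: (smooth_hpart oU (lc_smooth D_lc oU hX hY)).
Qed.

Lemma bottE X Y p : bott X Y p =
  D (hP X) (hP Y) p *m hpr p + lie A (vP X) (hP Y) p *m hpr p
  + lie A (hP X) (vP Y) p *m vpr p + D (vP X) (vP Y) p *m vpr p.
Proof. by []. Qed.

Lemma addrACA4 (W : zmodType) (a a' b b' c c' e e' : W) :
  a + a' + (b + b') + (c + c') + (e + e') = (a + b + c + e) + (a' + b' + c' + e').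
Proof. by rewrite (addrACA a) (addrACA (a + b)) (addrACA (a + b + c)). Qed.

Lemma bott_Dl U X X' Y p : open U -> svf U X -> svf U X' -> svf U Y -> U p ->
  bott (fun q => X q + X' q) Y p = bott X Y p + bott X' Y p.
Proof.
move=> oU sX sX' sY Up; have hX := smooth_hpart oU sX; have hY := smooth_hpart oU sY.
have vX := smooth_vpart oU sX; have vY := smooth_vpart oU sY.
have hX' := smooth_hpart oU sX'; have vX' := smooth_vpart oU sX'.
rewrite !bottE hpartD vpartD.
(* The additivity of [D] and of the bracket applies to the four parts as to any
   smooth fields. *)
move: (hpr p) (vpr p) (hpart g V) (vpart g V) hX hY vX vY hX' vX'.
move=> P Q h v hX hY vX vY hX' vX'.
rewrite (lc_Dl D_lc oU hX hX' hY Up) (lc_Dl D_lc oU vX vX' vY Up).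
move: (lie A) (lie_Dl D_lc oU vX vX' hY Up) (lie_Dl D_lc oU hX hX' vY Up) => L E1 E2.
by rewrite E1 E2 !mulmxDl addrACA4.
Qed.

Lemma bott_Dr U X Y Y' p : open U -> svf U X -> svf U Y -> svf U Y' -> U p ->
  bott X (fun q => Y q + Y' q) p = bott X Y p + bott X Y' p.
Proof.
move=> oU sX sY sY' Up; have hX := smooth_hpart oU sX; have hY := smooth_hpart oU sY.
have vX := smooth_vpart oU sX; have vY := smooth_vpart oU sY.
have hY' := smooth_hpart oU sY'; have vY' := smooth_vpart oU sY'.
rewrite !bottE hpartD vpartD.
move: (hpr p) (vpr p) (hpart g V) (vpart g V) hX hY vX vY hY' vY'.
move=> P Q h v hX hY vX vY hY' vY'.
rewrite (lc_Dr D_lc oU hX hY hY' Up) (lc_Dr D_lc oU vX vY vY' Up).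
move: (lie A) (lie_Dr D_lc oU vX hY hY' Up) (lie_Dr D_lc oU hX vY vY' Up) => L E1 E2.
by rewrite E1 E2 !mulmxDl addrACA4.
Qed.

(** The derivative of [f] in the brackets comes with a vertical factor under
    the horizontal projection, or the reverse. *)
Lemma bott_Zl U f X Y p : open U -> smooth_fun A U f -> svf U X -> svf U Y -> U p ->
  bott (fun q => f q *: X q) Y p = f p *: bott X Y p.
Proof.
move=> oU sf sX sY Up; have hX := smooth_hpart oU sX; have hY := smooth_hpart oU sY.
have vX := smooth_vpart oU sX; have vY := smooth_vpart oU sY.
have eh := hpr_ver (vpart_sub X p); have ev := vpr_hor (hpart_sub X p).
rewrite !bottE hpartZ vpartZ.
move: (hpr p) (vpr p) (hpart g V) (vpart g V) hX hY vX vY eh ev.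
move=> P Q h v hX hY vX vY eh ev.
rewrite (lc_Zl D_lc oU sf hX hY Up) (lc_Zl D_lc oU sf vX vY Up).
move: (lie A) (lie_Zl D_lc oU sf vX hY Up) (lie_Zl D_lc oU sf hX vY Up) => L E1 E2.
rewrite E1 E2 !mulmxBl -!scalemxAl.
by rewrite eh ev !scaler0 !subr0 !scalerDr.
Qed.

Lemma bott_Zr U f X Y p : open U -> smooth_fun A U f -> svf U X -> svf U Y -> U p ->
  bott X (fun q => f q *: Y q) p = vder X f p *: Y p + f p *: bott X Y p.
Proof.
move=> oU sf sX sY Up; have hX := smooth_hpart oU sX; have hY := smooth_hpart oU sY.
have vX := smooth_vpart oU sX; have vY := smooth_vpart oU sY.
have eh := hpr_hor (hpart_sub Y p); have ev := vpr_ver (vpart_sub Y p).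
have eX : vder X f p = vder (hP X) f p + vder (vP X) f p.
  by rewrite /Defs.vder {1}(hvpart X) (tder_vD _ _ oU sf Up).
have eY : Y p = hP Y p + vP Y p by rewrite {1}(hvpart Y).
rewrite !bottE hpartZ vpartZ eX eY.
move: (hpr p) (vpr p) (hpart g V) (vpart g V) hX hY vX vY eh ev {eX eY}.
move=> P Q h v hX hY vX vY eh ev.
rewrite (lc_Zr D_lc oU sf hX hY Up) (lc_Zr D_lc oU sf vX vY Up).
move: (lie A) (lie_Zr D_lc oU sf vX hY Up) (lie_Zr D_lc oU sf hX vY Up) => L E1 E2.
rewrite E1 E2; move: (D (h X) (h Y) p) (D (v X) (v Y) p) (L (v X) (h Y) p) (L (h X) (v Y) p).
move: (h Y p) (v Y p) eh ev (vder (h X) f p) (vder (v X) f p).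
move=> y y' eh ev c c' {E1 E2} d1 d2 l1 l2; rewrite !mulmxDl addrACA4 -!scalemxAl eh ev -!scalerDr.
move: (_ *: (_ + _ + _ + _)) => w.
by apply/rowP => i; rewrite !mxE; ring.
Qed.

Lemma bott_eqr U X Y Y' p : open U -> svf U X -> svf U Y -> svf U Y' -> U p ->
  (forall q, U q -> Y q = Y' q) -> bott X Y p = bott X Y' p.
Proof.
move=> oU sX sY sY' Up YY'; have hX := smooth_hpart oU sX; have hY := smooth_hpart oU sY.
have vX := smooth_vpart oU sX; have vY := smooth_vpart oU sY.
have hY' := smooth_hpart oU sY'; have vY' := smooth_vpart oU sY'.
have eh q : U q -> hP Y q = hP Y' q by move=> Uq; rewrite /hpart YY'.
have ev q : U q -> vP Y q = vP Y' q by move=> Uq; rewrite /vpart YY'.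
rewrite !bottE (lc_eqr D_lc oU hX hY hY' Up eh) (lc_eqr D_lc oU vX vY vY' Up ev).
by rewrite (lie_eqr D_lc oU vX hY hY' Up eh) (lie_eqr D_lc oU hX vY vY' Up ev).
Qed.

Lemma torsionC X Y U p : open U -> svf U X -> svf U Y -> U p ->
  torsion Y X p = - torsion X Y p.
Proof.
move=> oU sX sY Up; rewrite /Defs.torsion (lieC D_lc oU sX sY Up).
by rewrite [RHS]opprD opprB.
Qed.

Lemma torsion_Dr U X Y Y' p : open U -> svf U X -> svf U Y -> svf U Y' -> U p ->
  torsion X (fun q => Y q + Y' q) p = torsion X Y p + torsion X Y' p.
Proof.
move=> oU sX sY sY' Up; rewrite /Defs.torsion (bott_Dr oU sX sY sY' Up).
rewrite (bott_Dl oU sY sY' sX Up) (lie_Dr D_lc oU sX sY sY' Up).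
move: (bott X Y p) (bott Y X p) (bott X Y' p) (bott Y' X p) (lie A X Y p) (lie A X Y' p).
by move=> a b a' b' c c'; apply/rowP => i; rewrite !mxE; ring.
Qed.

Lemma torsion_Zr U f X Y p : open U -> smooth_fun A U f -> svf U X -> svf U Y -> U p ->
  torsion X (fun q => f q *: Y q) p = f p *: torsion X Y p.
Proof.
move=> oU sf sX sY Up; rewrite /Defs.torsion (bott_Zr oU sf sX sY Up).
rewrite (bott_Zl oU sf sY sX Up) (lie_Zr D_lc oU sf sX sY Up) !scalerBr.
by rewrite opprD addrA -[_ - _ - vder X f p *: _]addrA -opprD [_ *: bott Y X p + _]addrC opprD addrA [_ + f p *: _]addrC addrK.
Qed.

Lemma torsion_tensorialr U X Y Y' p : open U -> svf U X -> svf U Y -> svf U Y' -> U p ->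
  Y p = Y' p -> torsion X Y p = torsion X Y' p.
Proof.
move=> oU sX sY sY' Up; have sub W (WU : W `<=` U) := smooth_vfield_sub WU sX.
apply: (@tensorial _ _ _ A _ (fun Y => torsion X Y p) p U _ _ U) => //.
- by move=> W Z Z' oW Wp WU sZ sZ'; exact: (torsion_Dr oW (sub W WU) sZ sZ' Wp).
- by move=> W f Z oW Wp WU sf sZ; exact: (torsion_Zr oW sf (sub W WU) sZ Wp).
Qed.

Lemma torsion_tensorial U X X' Y Y' p : open U -> svf U X -> svf U X' ->
  svf U Y -> svf U Y' -> U p ->
  X p = X' p -> Y p = Y' p -> torsion X Y p = torsion X' Y' p.
Proof.
move=> oU sX sX' sY sY' Up eX eY; rewrite (torsion_tensorialr oU sX sY sY' Up eY).
rewrite (torsionC oU sY' sX Up) (torsion_tensorialr oU sY' sX sX' Up eX).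
by rewrite -(torsionC oU sY' sX' Up).
Qed.

Lemma torsion_atE U X Y p : open U -> svf U X -> svf U Y -> U p ->
  torsion_at p (X p) (Y p) = torsion X Y p.
Proof.
move=> oU sX sY Up; pose W := U `&` dom A p.
have oW : open W by apply: openI => //; exact: dom_open.
have Wp : W p by split=> //; exact: dom_mem.
have WU : W `<=` U by move=> q [].
have sc x : svf W (cfield A p x) by apply: smooth_vfield_sub (smooth_cfield A p x) => q [].
have sub Z (sZ : svf U Z) := smooth_vfield_sub WU sZ.
by apply: (torsion_tensorial oW (sc _) (sub _ sX) (sc _) (sub _ sY) Wp); rewrite cfield_self.
Qed.

Lemma torsion_at_linear p x : linear (torsion_at p x).
Proof.
have od := dom_open A p; have sx := smooth_cfield A p x; have dp := dom_mem A p.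
apply: (@tensorial_linear _ _ _ A _ (torsion (cfield A p x) ^~ p) p (dom A p)) => //.
- move=> W Z Z' oW Wp WU sZ sZ'.
  exact: (torsion_Dr oW (smooth_vfield_sub WU sx) sZ sZ' Wp).
- move=> W f Z oW Wp WU sf sZ.
  exact: (torsion_Zr oW sf (smooth_vfield_sub WU sx) sZ Wp).
Qed.

Lemma torsion_atC p x y : torsion_at p y x = - torsion_at p x y.
Proof.
exact: (torsionC (dom_open A p) (smooth_cfield A p x) (smooth_cfield A p y) (dom_mem A p)).
Qed.

Lemma torsion_smooth U X Y : open U -> svf U X -> svf U Y -> svf U (torsion X Y).
Proof.
move=> oU sX sY; apply: (smooth_vfieldB oU _ (lie_smooth D_lc oU sX sY)).
exact: (smooth_vfieldB oU (bott_smooth oU sX sY) (bott_smooth oU sY sX)).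
Qed.

(** The horizontal part of the torsion is minus the horizontal part of the
    bracket of the vertical components, and that bracket is vertical because
    the leaves are totally geodesic. *)
Lemma torsion_vertical U X Y p : open U -> svf U X -> svf U Y -> U p ->
  (torsion X Y p <= V p)%MS.
Proof.
move=> oU sX sY Up; have hX := smooth_hpart oU sX; have hY := smooth_hpart oU sY.
have vX := smooth_vpart oU sX; have vY := smooth_vpart oU sY.
suff T0 : torsion X Y p *m hpr p = 0.
  rewrite (hv_decomp p (torsion X Y p)) T0 add0r.
  exact: (vpr_sub).
have lie_v : lie A (vP X) (vP Y) p *m hpr p = 0.
  rewrite (lc_lie D_lc oU vX vY Up) hpr_ver//.
  apply: addmx_sub; first by apply: (V_tg oU vX vY) => // q _; exact: vpart_sub.
  by rewrite eqmx_opp; apply: (V_tg oU vY vX) => // q _; exact: vpart_sub.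
have eL : lie A X Y p = lie A (hP X) (hP Y) p + lie A (hP X) (vP Y) p
    + (lie A (vP X) (hP Y) p + lie A (vP X) (vP Y) p).
  rewrite {1}(hvpart X) {1}(hvpart Y).
  move: (hpart g V) (vpart g V) hX hY vX vY => h v hX hY vX vY.
  move: (lie A) (lie_Dl D_lc oU hX vX (smooth_vfieldD oU hY vY) Up)
    (lie_Dr D_lc oU hX hY vY Up) (lie_Dr D_lc oU vX hY vY Up) => L E1 E2 E3.
  by rewrite E1 E2 E3.
have eC := lieC D_lc oU hX vY Up.
have eD := lc_lie D_lc oU hX hY Up.
rewrite /Defs.torsion !bottE eL eC eD.
move: (lie A (hP X) (vP Y) p) (lie A (vP X) (hP Y) p) (lie A (vP X) (vP Y) p) lie_v => a b c cv.
move: (D (hP X) (hP Y) p) (D (hP Y) (hP X) p) (D (vP X) (vP Y) p) (D (vP Y) (vP X) p).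
move=> e e' k k'; rewrite !mulmxBl !mulmxDl !mulNmx !(hpr_idem p) !(hpr_vpr p) cv.
move: (e *m _) (e' *m _) (a *m _) (b *m _) => {e e' a b c cv} e e' a b.
by apply/rowP => i; rewrite !mxE; ring.
Qed.

(* Only the properties proved above are used from here on. *)
#[local] Opaque sharp Defs.torsion Defs.bott.

Lemma gip_sharpE p a y : ip p (sharp g p a) y = pairing a y.
Proof. by apply: gip_sharp => *; exact: gpos. Qed.
Lemma gip_hprr p x y : ip p x (y *m hpr p) = ip p (x *m hpr p) (y *m hpr p).
Proof. by apply: gip_hr => *; [exact: gsym|exact: gpos]. Qed.
Lemma gip_vprr p x y : ip p x (y *m vpr p) = ip p (x *m vpr p) (y *m vpr p).
Proof. by apply: gip_vr => *; [exact: gsym|exact: gpos]. Qed.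

(** * The Bott connection is metric along horizontal directions *)

Section horizontal_direction.
Variables (U : set M) (X : vfield R (n + m) M).
Hypotheses (oU : open U) (sX : svf U X).
Hypothesis X_hor : forall q, U q -> (X q <= hspace g V q)%MS.

(** Along a horizontal direction [nabla] differs from the projected Levi-Civita
    derivative only by the shape operator [(D_Y X)_V] of the leaves. *)
Lemma bott_horE Y p : svf U Y -> U p -> bott X Y p =
  D X (hP Y) p *m hpr p + (D X (vP Y) p - D (vP Y) X p) *m vpr p.
Proof.
move=> sY Up; have hX := smooth_hpart oU sX; have hY := smooth_hpart oU sY.
have vX := smooth_vpart oU sX; have vY := smooth_vpart oU sY.
have eX q : U q -> hP X q = X q by move=> Uq; rewrite /hpart hpr_hor// X_hor.
have eX0 q : U q -> vP X q = 0 by move=> Uq; rewrite /vpart vpr_hor// X_hor.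
have E1 : lie A (vP X) (hP Y) p = 0.
  by rewrite (lieC D_lc oU hY vX Up) (lie_0r D_lc oU hY vX Up eX0) oppr0.
have E2 : lie A (hP X) (vP Y) p = D X (vP Y) p - D (vP Y) X p.
  rewrite (lc_lie D_lc oU hX vY Up) (lc_tensorial D_lc oU hX sX vY Up (eX _ Up)).
  by rewrite (lc_eqr D_lc oU vY hX sX Up eX).
rewrite bottE E1 E2 (lc_0l D_lc oU vX vY Up (eX0 _ Up)).
by rewrite (lc_tensorial D_lc oU hX sX hY Up (eX _ Up)) !mul0mx !addr0.
Qed.

(** Differentiate [g(X, Z) = 0] along the vertical field [Y]: the term
    [g(X, D_Y Z)] vanishes for totally geodesic leaves. *)
Lemma second_fundamental_form_eq0 Y Z p : svf U Y -> svf U Z -> U p ->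
  (forall q, U q -> (Y q <= V q)%MS) -> (forall q, U q -> (Z q <= V q)%MS) ->
  ip p (D Y X p) (Z p) = 0.
Proof.
move=> sY sZ Up Yv Zv; have := lc_metric D_lc oU sY sX sZ Up.
have E0 : vder Y (fun q => ip q (X q) (Z q)) p = 0.
  rewrite -[RHS](tder_cst A p (Y p) 0).
apply: (tder_eq A _ oU Up) => q Uq.
  by rewrite (gip_orth (V := V)) ?X_hor ?Zv.
rewrite E0.
rewrite [ip p (X p) _](gip_orth (V := V)) ?X_hor ?addr0//.
exact: (V_tg oU sY sZ Yv Zv Up).
Qed.

Lemma bott_metric_h Y Z p : svf U Y -> svf U Z -> U p ->
  vder X (fun q => ip q (Y q *m hpr q) (Z q *m hpr q)) p =
  ip p (bott X Y p *m hpr p) (Z p *m hpr p) + ip p (Y p *m hpr p) (bott X Z p *m hpr p).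
Proof.
move=> sY sZ Up; have hY := smooth_hpart oU sY; have hZ := smooth_hpart oU sZ.
have E (W : vfield R (n + m) M) : svf U W -> bott X W p *m hpr p = D X (hP W) p *m hpr p.
  by move=> sW; rewrite (bott_horE sW Up) mulmxDl hpr_idem hpr_vpr addr0.
rewrite (E _ sY) (E _ sZ) -gip_hr ?gsym//; last by move=> *; exact: gpos.
rewrite -gip_hl ?gsym//; last by move=> *; exact: gpos.
exact: (lc_metric D_lc oU sX hY hZ Up).
Qed.

Lemma bott_metric_v Y Z p : svf U Y -> svf U Z -> U p ->
  vder X (fun q => ip q (Y q *m vpr q) (Z q *m vpr q)) p =
  ip p (bott X Y p *m vpr p) (Z p *m vpr p) + ip p (Y p *m vpr p) (bott X Z p *m vpr p).
Proof.
move=> sY sZ Up; have vY := smooth_vpart oU sY; have vZ := smooth_vpart oU sZ.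
have E (W : vfield R (n + m) M) : svf U W -> bott X W p *m vpr p = (D X (vP W) p - D (vP W) X p) *m vpr p.
  by move=> sW; rewrite (bott_horE sW Up) mulmxDl vpr_hpr vpr_idem add0r.
have vsub (W : vfield R (n + m) M) q : U q -> (vP W q <= V q)%MS by move=> _; exact: vpr_sub.
rewrite (E _ sY) (E _ sZ) -gip_vr ?gsym//; last by move=> *; exact: gpos.
rewrite -gip_vl ?gsym//; last by move=> *; exact: gpos.
rewrite gipDl gipDr ?gsym// gipNl gipNr ?gsym//.
have e1 := second_fundamental_form_eq0 vY vZ Up (vsub Y) (vsub Z).
have e2 := second_fundamental_form_eq0 vZ vY Up (vsub Z) (vsub Y).
rewrite [ip p _ (D (vP Z) X p)]gipC ?gsym// e1 e2 oppr0 !addr0.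
exact: (lc_metric D_lc oU sX vY vZ Up).
Qed.

End horizontal_direction.

Local Notation nabla := (nabla_form A g V D).

(** The connection on one-forms satisfies the product rule for the pairing
    with any smooth field: the difference [L] of the two other terms is
    tensorial in the field. *)
Section nabla_form.
Variables (U : set M) (X : vfield R (n + m) M) (alpha : oneform R (n + m) M).
Hypotheses (oU : open U) (sX : svf U X) (sa : smooth_form A U alpha).
Variable p : M.
Hypothesis Up : U p.
Local Notation L := (fun Y => vder X (fun q => pairing (alpha q) (Y q)) p
  - pairing (alpha p) (bott X Y p)).

Lemma smooth_form_sub W : W `<=` U -> smooth_form A W alpha.
Proof. by move=> WU a k; apply: smooth_fun_sub (sa a k) => q [/WU]. Qed.

Lemma nabla_form_D W Y Y' : open W -> W p -> W `<=` U -> svf W Y -> svf W Y' ->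
  L (fun r => Y r + Y' r) = L Y + L Y'.
Proof.
move=> oW Wp WU sY sY'; have sXW := smooth_vfield_sub WU sX; have saW := smooth_form_sub WU.
have E : (fun q => pairing (alpha q) (Y q + Y' q)) =
  fun q => pairing (alpha q) (Y q) + pairing (alpha q) (Y' q).
  by apply/funext => q; rewrite pairingDr.
rewrite E /Defs.vder (tderD _ oW (smooth_pairing oW saW sY) (smooth_pairing oW saW sY') Wp).
rewrite (bott_Dr oW sXW sY sY' Wp) pairingDr.
by rewrite opprD addrACA.
Qed.

Lemma nabla_form_Z W f Y : open W -> W p -> W `<=` U -> smooth_fun A W f -> svf W Y ->
  L (fun r => f r *: Y r) = f p *: (L Y : R^o).
Proof.
move=> oW Wp WU sf sY; have sXW := smooth_vfield_sub WU sX; have saW := smooth_form_sub WU.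
have E : (fun q => pairing (alpha q) (f q *: Y q)) =
  fun q => f q * pairing (alpha q) (Y q).
  by apply/funext => q; rewrite pairingZr.
rewrite E /Defs.vder (tderM _ oW sf (smooth_pairing oW saW sY) Wp).
rewrite (bott_Zr oW sf sXW sY Wp) pairingDr !pairingZr /GRing.scale /=.
rewrite /Defs.vder; ring.
Qed.

Lemma nabla_formE Y : svf U Y -> pairing (nabla X alpha p) (Y p) = L Y.
Proof.
move=> sY; rewrite pairing_covec.
  exact: (tensorial_cfield (L := L : _ -> R^o) nabla_form_D nabla_form_Z oU Up (fun x => id) sY).
exact: (tensorial_linear (L := L : _ -> R^o) oU Up nabla_form_D nabla_form_Z).
Qed.
End nabla_form.


(** * The twisted connection is metric *)

Section twisted.
Variable eps : R.
Hypothesis eps_neq0 : eps != 0.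
Local Notation ipe := (ip_eps g V eps).
Local Notation sharp := (sharp g).

(** The vector that represents the covector [a] for the metric
    [gip_eps = g_H + (1/eps) g_V], whose dual metric on covectors is
    [ip_eps]. *)
Definition esharp p (a : 'rV[R]_(n + m)) : 'rV[R]_(n + m) :=
  sharp p a *m hpr p + eps *: (sharp p a *m vpr p).
Local Notation es := esharp.

Definition gip_eps p (x y : 'rV[R]_(n + m)) : R :=
  ip p (x *m hpr p) (y *m hpr p) + eps^-1 * ip p (x *m vpr p) (y *m vpr p).

Lemma esharp_h p a : es p a *m hpr p = sharp p a *m hpr p.
Proof. by rewrite mulmxDl hpr_idem -scalemxAl hpr_vpr scaler0 addr0. Qed.

Lemma esharp_v p a : es p a *m vpr p = eps *: (sharp p a *m vpr p).
Proof. by rewrite mulmxDl vpr_hpr -scalemxAl vpr_idem add0r. Qed.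

Lemma pairing_gip p a x : pairing a x =
  ip p (sharp p a *m hpr p) (x *m hpr p) + ip p (sharp p a *m vpr p) (x *m vpr p).
Proof.
rewrite -(gip_sharpE p) {1}(hv_decomp p x).
by rewrite gipDr ?gsym// gip_hprr gip_vprr.
Qed.

Lemma ip_epsE p a b : ipe p a b = pairing a (es p b).
Proof.
rewrite /ip_eps ip_hE ?ip_vE ?gsym//; try by move=> *; exact: gpos.
by rewrite pairingDr pairingZr.
Qed.

Lemma ip_epsC p a b : ipe p a b = ipe p b a.
Proof.
rewrite !ip_epsE !(pairing_gip p) !esharp_h !esharp_v !gipZr ?gsym//.
by rewrite gipC ?gsym// [ip p (_ *m vpr p) _]gipC ?gsym.
Qed.

Lemma ip_epsDl p a a' b : ipe p (a + a') b = ipe p a b + ipe p a' b.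
Proof. by rewrite !ip_epsE pairingDl. Qed.
Lemma ip_epsZl p c a b : ipe p (c *: a) b = c * ipe p a b.
Proof. by rewrite !ip_epsE pairingZl. Qed.
Lemma ip_epsNl p a b : ipe p (- a) b = - ipe p a b.
Proof. by rewrite !ip_epsE pairingNl. Qed.
Lemma ip_eps_suml p (I : Type) (r : seq I) (F : I -> 'rV[R]_(n + m)) b :
  ipe p (\sum_(i <- r) F i) b = \sum_(i <- r) ipe p (F i) b.
Proof.
elim: r => [|i r IH]; last by rewrite !big_cons ip_epsDl IH.
by rewrite !big_nil -(scale0r 0) ip_epsZl mul0r.
Qed.

Lemma pairing_esharp p a x : pairing a x = gip_eps p (es p a) x.
Proof.
rewrite (pairing_gip p) /gip_eps esharp_h esharp_v gipZl mulrA mulVf// mul1r.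
by [].
Qed.

Lemma smooth_esharp U alpha : open U -> smooth_form A U alpha ->
  svf U (fun q => es q (alpha q)).
Proof.
move=> oU sa; have ss := smooth_sharp g_metric oU sa.
apply: (smooth_vfieldD oU (smooth_hpart oU ss)).
exact: (smooth_vfieldZ oU (smooth_fun_cst A U eps) (smooth_vpart oU ss)).
Qed.

Lemma smooth_ip_eps U alpha beta : open U -> smooth_form A U alpha ->
  smooth_form A U beta -> smooth_fun A U (fun q => ipe q (alpha q) (beta q)).
Proof.
move=> oU sa sb.
rewrite (_ : (fun q => _) = fun q => pairing (alpha q) (es q (beta q))).
  exact: (smooth_pairing oU sa (smooth_esharp oU sb)).
by apply/funext => q; rewrite ip_epsE.
Qed.

Local Notation T := torsion_at.
Local Notation J p z := (Jmap A g V D p z).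

Lemma torsion_at_D p x y z : T p x (y + z) = T p x y + T p x z.
Proof.
have := torsion_at_linear p x 1 y z.
by rewrite /= !scale1r.
Qed.

Lemma torsion_at_Z p x c y : T p x (c *: y) = c *: T p x y.
Proof.
have T0 : T p x 0 = 0.
  have := torsion_at_D p x 0 0; rewrite addr0 => /eqP.
  by rewrite -subr_eq0 opprD addNKr oppr_eq0 => /eqP.
have := torsion_at_linear p x c y 0.
by rewrite /= addr0 T0 addr0.
Qed.

Lemma torsion_at_Dl p x y z : T p (y + z) x = T p y x + T p z x.
Proof.
move: (torsion_at p) (torsion_at_D p) (torsion_atC p) => t tD tC.
by rewrite (tC x (y + z)) (tC x y) (tC x z) tD opprD.
Qed.

Lemma torsion_at_Zl p x c y : T p (c *: y) x = c *: T p y x.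
Proof.
move: (torsion_at p) (torsion_at_Z p) (torsion_atC p) => t tZ tC.
by rewrite (tC x (c *: y)) (tC x y) tZ scalerN.
Qed.

Lemma torsion_at_vertical p x y : (T p x y <= V p)%MS.
Proof.
exact: (torsion_vertical (dom_open A p)
  (smooth_cfield A p x) (smooth_cfield A p y) (dom_mem A p)).
Qed.

(** The defining property of [J]; it needs the torsion to be a tensor, since
    [J] is built from its values on coordinate fields. *)
Lemma Jmap_gip p z x y :
  ip p (x *m J p z) y = ip p (z *m vpr p) (T p (x *m hpr p) (y *m hpr p)).
Proof.
pose F u := sharp p (covec (fun y0 =>
    ip p (z *m vpr p) (T p (u *m hpr p) (y0 *m hpr p)))).
have E u w : ip p (F u) w = ip p (z *m vpr p) (T p (u *m hpr p) (w *m hpr p)).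
  rewrite gip_sharpE pairing_covec// => c a b.
  by rewrite mulmxDl -scalemxAl torsion_at_D torsion_at_Z gipDr ?gsym// gipZr ?gsym.
rewrite -[Jmap _ _ _ _ _ _]/(endo F) -E; move: F E => F E.
rewrite mul_endo// => c u v.
apply: (gip_inj (@metric_pos _ _ _ _ _ g_metric p)) => w.
rewrite [RHS]gipDl gipZl !E mulmxDl -scalemxAl.
by rewrite torsion_at_Dl torsion_at_Zl gipDr ?gsym// gipZr ?gsym.
Qed.

#[local] Opaque Jmap Defs.torsion_at.

Lemma Jmap_hor p z (x : 'rV_(n + m)) : (x *m J p z <= hspace g V p)%MS.
Proof.
apply/hspaceP => v vV; rewrite Jmap_gip (hpr_ver vV).
have := torsion_at_Z p (x *m hpr p) 0 0; rewrite !scale0r => ->.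
by rewrite gip0r ?gsym.
Qed.

Lemma Jmap_linear p c z z' (x : 'rV_(n + m)) :
  x *m J p (c *: z + z') = c *: (x *m J p z) + x *m J p z'.
Proof.
apply: (gip_inj (@metric_pos _ _ _ _ _ g_metric p)) => w.
by rewrite gipDl gipZl !Jmap_gip mulmxDl -scalemxAl gipDl gipZl.
Qed.

Local Notation Te := (Teps_form A g V D eps).

Lemma Teps_formE X alpha p y : pairing (Te X alpha p) y =
  eps^-1 * pairing (alpha p) (X p *m J p (y *m vpr p))
  - pairing (alpha p) (T p (X p) (y *m hpr p)).
Proof.
rewrite pairing_covec// => c u v.
rewrite !mulmxDl -!scalemxAl Jmap_linear torsion_at_D torsion_at_Z.
move: (X p *m J p (u *m vpr p)) (X p *m J p (v *m vpr p)) => j j'.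
move: (T p (X p) (u *m hpr p)) (T p (X p) (v *m hpr p)) => t t'.
rewrite !pairingDr !pairingZr /GRing.scale /=; ring.
Qed.

(** [T_X] exchanges the horizontal and vertical parts of a form through [J] and
    through the torsion, which are adjoint to each other by [Jmap_gip]; the
    factor [1/eps] cancels the weight [eps] of vertical forms. *)
Lemma Teps_skew X alpha beta p : (X p <= hspace g V p)%MS ->
  ipe p (Te X alpha p) (beta p) = - ipe p (alpha p) (Te X beta p).
Proof.
move=> Xh; rewrite [in RHS]ip_epsC !ip_epsE !Teps_formE !esharp_h !esharp_v.
have EJ a b : pairing a (X p *m J p (eps *: (sharp p b *m vpr p)))
    = eps * ip p (sharp p b *m vpr p) (T p (X p) (sharp p a *m hpr p)).
  rewrite -(gip_sharpE p) gipC ?gsym// Jmap_gip.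
  by rewrite (hpr_hor Xh) -scalemxAl vpr_idem gipZl.
have ET a b : pairing a (T p (X p) (sharp p b *m hpr p))
    = ip p (sharp p a *m vpr p) (T p (X p) (sharp p b *m hpr p)).
  rewrite -(gip_sharpE p).
  by rewrite -[T p _ _](vpr_ver (torsion_at_vertical _ _ _)) gip_vprr.
move: (Jmap A g V D p) (torsion_at p) EJ ET => j t EJ ET.
by rewrite !EJ !ET !mulrA !mulVf// !mul1r opprB.
Qed.

(** The field [J_Z X] is the sharp of the form [Y |-> g(Z_V, T(X_H, Y_H))]. *)
Lemma smooth_Jmap_apply U X Z : open U -> svf U X -> svf U Z -> svf U (fun q => X q *m J q (Z q)).
Proof.
move=> oU sX sZ; have hX := smooth_hpart oU sX; have vZ := smooth_vpart oU sZ.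
pose w : oneform R (n + m) M := fun q =>
  covec (fun y => ip q (Z q *m vpr q) (T q (X q *m hpr q) (y *m hpr q))).
have wE q y : pairing (w q) y = ip q (Z q *m vpr q) (T q (X q *m hpr q) (y *m hpr q)).
  rewrite pairing_covec// => c u v.
  by rewrite mulmxDl -scalemxAl torsion_at_D torsion_at_Z gipDr ?gsym// gipZr ?gsym.
have sw : smooth_form A U w.
  move=> a k; have oUa : open (U `&` dom A a) by apply: openI => //; exact: dom_open.
  have sub : U `&` dom A a `<=` U by move=> q [].
  have sc := smooth_vfield_sub (fun q (h : (U `&` dom A a) q) => proj2 h) (smooth_cfield A a (delta_mx 0 k)).
  have hc := smooth_hpart oUa sc; have hXa := smooth_vfield_sub sub hX.
  have sT : svf (U `&` dom A a) (torsion (hP X) (hP (cfield A a (delta_mx 0 k)))).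
    exact: torsion_smooth oUa hXa hc.
  apply: (smooth_fun_eq oUa _ (smooth_gip g_metric oUa (smooth_vfield_sub sub vZ) sT)).
  move=> q Uq; rewrite wE.
  exact: (congr1 (gip g q (Z q *m vpr q)) (esym (torsion_atE oUa hXa hc Uq))).
have := smooth_sharp g_metric oU sw; apply: (smooth_vfield_eq oU) => q Uq.
apply: (sharp_uniq (@metric_pos _ _ _ _ _ g_metric q)) => y.
by rewrite Jmap_gip wE.
Qed.

Section horizontal.
Variables (U : set M) (X : vfield R (n + m) M).
Hypotheses (oU : open U) (sX : svf U X).
Hypothesis X_hor : forall q, U q -> (X q <= hspace g V q)%MS.

Lemma bott_metric_eps Y Z p : svf U Y -> svf U Z -> U p ->
  vder X (fun q => gip_eps q (Y q) (Z q)) p =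
  gip_eps p (bott X Y p) (Z p) + gip_eps p (Y p) (bott X Z p).
Proof.
move=> sY sZ Up; have hY := smooth_hpart oU sY; have hZ := smooth_hpart oU sZ.
have vY := smooth_vpart oU sY; have vZ := smooth_vpart oU sZ.
have sh := smooth_gip g_metric oU hY hZ; have sv := smooth_gip g_metric oU vY vZ.
have sc := smooth_fun_cst A U eps^-1.
rewrite /gip_eps /Defs.vder (tderD _ oU sh (smooth_funM oU sc sv) Up).
rewrite (tderM _ oU sc sv Up) tder_cst mulr0 addr0.
have := bott_metric_h oU sX X_hor sY sZ Up; rewrite /Defs.vder => ->.
have := bott_metric_v oU sX X_hor sY sZ Up; rewrite /Defs.vder => ->.
by rewrite mulrDr addrACA.
Qed.

(** Dual to [bott_metric_eps]: the product rule for each of [alpha(beta^#)] and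
    [beta(alpha^#)], which are both the inner product, is compared with that
    for the inner product of the fields [alpha^#] and [beta^#]. *)
Lemma nabla_form_metric alpha beta p : smooth_form A U alpha -> smooth_form A U beta ->
  U p -> vder X (fun q => ipe q (alpha q) (beta q)) p =
  ipe p (nabla X alpha p) (beta p) + ipe p (alpha p) (nabla X beta p).
Proof.
move=> sa sb Up; have ea := smooth_esharp oU sa; have eb := smooth_esharp oU sb.
have Ea : (fun q => ipe q (alpha q) (beta q)) = fun q => pairing (alpha q) (es q (beta q)).
  by apply/funext => q; rewrite ip_epsE.
have Eb : (fun q => ipe q (alpha q) (beta q)) = fun q => pairing (beta q) (es q (alpha q)).
  by apply/funext => q; rewrite ip_epsC ip_epsE.
have Eg : (fun q => ipe q (alpha q) (beta q)) =
    fun q => gip_eps q (es q (alpha q)) (es q (beta q)).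
  by rewrite Ea; apply/funext => q; rewrite -pairing_esharp.
have := bott_metric_eps ea eb Up; rewrite -Eg.
rewrite [ipe p (alpha p) _]ip_epsC !ip_epsE.
rewrite (nabla_formE oU sX sa Up eb) (nabla_formE oU sX sb Up ea) -Ea -Eb.
rewrite ![pairing _ (bott _ _ _)](pairing_esharp p) => E.
have C x y : gip_eps p x y = gip_eps p y x.
  by rewrite /gip_eps gipC ?gsym// [ip p (_ *m vpr p) _]gipC ?gsym.
rewrite (C _ (bott X (fun q => es q (alpha q)) p)); move: E.
by move: (vder _ _ _) (gip_eps _ _ _) (gip_eps _ _ _) => a b c ->; ring.
Qed.


Local Notation tw := (twisted A g V D eps).

Lemma twisted_metric alpha beta p : smooth_form A U alpha -> smooth_form A U beta ->
  U p -> vder X (fun q => ipe q (alpha q) (beta q)) p =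
  ipe p (tw X alpha p) (beta p) + ipe p (alpha p) (tw X beta p).
Proof.
move=> sa sb Up; rewrite (nabla_form_metric sa sb Up) /twisted.
rewrite ip_epsDl ip_epsNl [ipe p _ (_ - _)]ip_epsC ip_epsDl ip_epsNl.
rewrite (Teps_skew _ _ (X_hor Up)) ![ipe p _ (alpha p)]ip_epsC; ring.
Qed.

Lemma smooth_twisted alpha : smooth_form A U alpha -> smooth_form A U (tw X alpha).
Proof.
move=> sa a k; have oUa : open (U `&` dom A a) by apply: openI => //; exact: dom_open.
have sub : U `&` dom A a `<=` U by move=> q [].
set c := cfield A a (delta_mx 0 k).
have sc : svf (U `&` dom A a) c.
  by apply: smooth_vfield_sub (smooth_cfield A a (delta_mx 0 k)) => q [].
have hc := smooth_hpart oUa sc; have vc := smooth_vpart oUa sc.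
have sXa := smooth_vfield_sub sub sX; have saa := smooth_form_sub sa sub.
have hXa := smooth_hpart oUa sXa.
have sT : svf (U `&` dom A a) (torsion X (hP c)).
  exact: torsion_smooth oUa sXa hc.
have sB := smooth_pairing oUa saa (bott_smooth oUa sXa sc).
have sD := vder_smooth oUa sXa (smooth_pairing oUa saa sc).
have sJ := smooth_pairing oUa saa (smooth_Jmap_apply oUa sXa vc).
have sTa := smooth_pairing oUa saa sT.
have sE := smooth_funM oUa (smooth_fun_cst A _ eps^-1) sJ.
apply: (smooth_fun_eq oUa _ (smooth_funB oUa (smooth_funB oUa sD sB) (smooth_funB oUa sE sTa))).
move=> q Uq; rewrite /twisted pairingDl pairingNl (nabla_formE oUa sXa saa Uq sc) Teps_formE.
by rewrite -(torsion_atE oUa sXa hc Uq).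
Qed.

(** The Bott derivative of a horizontal field along itself is a horizontal
    direction, so that [twisted_metric] also applies along it. *)
Lemma bott_self_hor p : U p -> (bott X X p <= hspace g V p)%MS.
Proof.
move=> Up; have vX := smooth_vpart oU sX.
have eX0 q : U q -> vP X q = 0 by move=> Uq; rewrite /vpart vpr_hor// X_hor.
rewrite (bott_horE oU sX X_hor sX Up) (lc_0r D_lc oU sX Up eX0).
by rewrite (lc_0l D_lc oU vX sX Up (eX0 _ Up)) subrr mul0mx addr0 hpr_sub.
Qed.

End horizontal.

(** * The identity in one direction and the zero order terms *)

(** Apply [twisted_metric] along [X] twice, and along [nabla_X X] once. *)
Lemma bochner_direction U X eta p : open U -> svf U X ->
  (forall q, U q -> (X q <= hspace g V q)%MS) -> smooth_form A U eta -> U p ->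
  2^-1 * (vder X (vder X (fun q => ipe q (eta q) (eta q))) p
    - vder (bott X X) (fun q => ipe q (eta q) (eta q)) p) =
  ipe p (twisted A g V D eps X (twisted A g V D eps X eta) p
         - twisted A g V D eps (bott X X) eta p) (eta p)
  + ipe p (twisted A g V D eps X eta p) (twisted A g V D eps X eta p).
Proof.
move=> oU sX Xh se Up; have st := smooth_twisted oU sX se.
have sB := bott_smooth oU sX sX; have Bh := bott_self_hor oU sX Xh.
rewrite (twisted_metric oU sB Bh se se Up).
have E q : U q -> vder X (fun q => ipe q (eta q) (eta q)) q =
    ipe q (twisted A g V D eps X eta q) (eta q) + ipe q (twisted A g V D eps X eta q) (eta q).
  by move=> Uq; rewrite (twisted_metric oU sX Xh se se Uq) [ipe q (eta q) _]ip_epsC.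
have s1 := smooth_ip_eps oU st se.
have -> : vder X (vder X (fun q => ipe q (eta q) (eta q))) p =
    vder X (fun q => ipe q (twisted A g V D eps X eta q) (eta q)) p
    + vder X (fun q => ipe q (twisted A g V D eps X eta q) (eta q)) p.
  by rewrite -(tderD _ oU s1 s1 Up); apply: (tder_eq A _ oU Up) E.
rewrite (twisted_metric oU sX Xh st se Up) ip_epsDl ip_epsNl.
move: (twisted _ _ _ _ _ _ _ p) (twisted _ _ _ _ _ _ _ p) (twisted _ _ _ _ _ _ _ p) => t w u.
rewrite [ipe p (eta p) _]ip_epsC.
by move: (ipe _ _ _) (ipe _ _ _) (ipe _ _ _) => a b c; lra.
Qed.

(** The chosen frame is horizontal and smooth near the point; this also holds
    for the zero fields which stand for a frame where none exists, so that
    each term of the sums over the frame is covered in both cases. *)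
Lemma hframe_spec p i : exists U, [/\ open U, U p, svf U (hframe A g V p i) &
  forall q, U q -> (hframe A g V p i q <= hspace g V q)%MS].
Proof.
rewrite /hframe /onframe; case: xgetP => [X _ [U [oU Up sX XE]]|_].
  by exists U; split => // q Uq; have [h _] := XE q Uq; exact: h.
exists setT; split => //; [exact: openT|exact: smooth_vfield0|].
by move=> q _; rewrite sub0mx.
Qed.

Lemma bott_vertical U X Y p : open U -> svf U X -> svf U Y -> U p ->
  (forall q, U q -> (Y q <= V q)%MS) -> (bott X Y p <= V p)%MS.
Proof.
move=> oU sX sY Up Yv; have hX := smooth_hpart oU sX; have hY := smooth_hpart oU sY.
have vX := smooth_vpart oU sX.
have e0 q : U q -> hP Y q = 0 by move=> Uq; rewrite /hpart hpr_ver// Yv.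
rewrite bottE (lc_0r D_lc oU hX Up e0) (lie_0r D_lc oU vX hY Up e0) !mul0mx !add0r.
by rewrite addmx_sub// vpr_sub.
Qed.

(** The torsion is vertical, and [nabla] preserves vertical fields. *)
Lemma deltaT_vertical p (x : 'rV[R]_(n + m)) : (x *m deltaT A g V D p <= V p)%MS.
Proof.
apply: (submx_trans (submxMl _ _)); apply/row_subP => k; rewrite rowK.
rewrite eqmx_opp summx_sub// => j _.
have [U [oU Up sX _]] := hframe_spec p j.
pose W := U `&` dom A p.
have oW : open W by apply: openI => //; exact: dom_open.
have Wp : W p by split=> //; exact: dom_mem.
have sXW : svf W (hframe A g V p j) by apply: smooth_vfield_sub sX => q [].
have sc : svf W (cfield A p (delta_mx 0 k)).
  by apply: smooth_vfield_sub (smooth_cfield A p (delta_mx 0 k)) => q [].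
have tv Y Z q : svf W Y -> svf W Z -> W q -> (torsion Y Z q <= V q)%MS.
  by move=> sY sZ; exact: (torsion_vertical oW sY sZ).
rewrite /nabla_torsion; apply: addmx_sub; last first.
  by rewrite eqmx_opp; exact: (tv _ _ _ sXW (bott_smooth oW sXW sc) Wp).
apply: addmx_sub; last first.
  by rewrite eqmx_opp; exact: (tv _ _ _ (bott_smooth oW sXW sXW) sc Wp).
apply: (bott_vertical oW sXW (torsion_smooth oW sXW sc) Wp) => q Wq.
exact: tv.
Qed.

Lemma J2_horizontal p (x : 'rV[R]_(n + m)) : (x *m J2 A g V D p <= hspace g V p)%MS.
Proof.
rewrite /J2 mulmx_sumr summx_sub// => l _; rewrite mulmxA; exact: Jmap_hor.
Qed.

Lemma cfield_linear a q c u v : dom A a q ->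
  cfield A a (c *: u + v) q = c *: cfield A a u q + cfield A a v q.
Proof.
move=> aq; apply: (tangent_vector_eq aq) => i.
have sc := smooth_coord A a i; have oa := dom_open A a.
have E x : tder A q (cfield A a x q) (fun r => phi A a r 0 i) = x 0 i.
  exact: (cfield_coord x i aq).
move: (cfield A a (c *: u + v) q) (cfield A a u q) (cfield A a v q)
  (E u) (E v) (E (c *: u + v)) => w wu wv e1 e2 e3.
by rewrite (tder_vD _ _ oa sc aq) (tder_vZ _ _ oa sc aq) e1 e2 e3 !mxE.
Qed.

Lemma bott_lin U X Y Y' c p : open U -> svf U X -> svf U Y -> svf U Y' -> U p ->
  bott X (fun q => c *: Y q + Y' q) p = c *: bott X Y p + bott X Y' p.
Proof.
move=> oU sX sY sY' Up; have sc := smooth_fun_cst A U c.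
rewrite (bott_Dr oU sX (smooth_vfieldZ oU sc sY) sY' Up).
rewrite (bott_Zr oU sc sX sY Up).
by rewrite /Defs.vder tder_cst scale0r add0r.
Qed.

(** The germ of [cfield p (c *: u + v)] is the combination of those of the
    other two, and [nabla] is local in the field that it differentiates. *)
Lemma curvature_linear p X Y c u v : svf (dom A p) X -> svf (dom A p) Y ->
  curvature A g V D X Y (cfield A p (c *: u + v)) p =
  c *: curvature A g V D X Y (cfield A p u) p + curvature A g V D X Y (cfield A p v) p.
Proof.
move=> sX sY; have oU := dom_open A p; have Up := dom_mem A p.
have s x := smooth_cfield A p x.
have sL : svf (dom A p) (fun q => c *: cfield A p u q + cfield A p v q).
  by apply: (smooth_vfieldD oU _ (s v)); exact: (smooth_vfieldZ oU (smooth_fun_cst A _ c) (s u)).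
have B Z q : svf (dom A p) Z -> dom A p q -> bott Z (cfield A p (c *: u + v)) q =
    c *: bott Z (cfield A p u) q + bott Z (cfield A p v) q.
  move=> sZ qp; rewrite -(bott_lin c oU sZ (s u) (s v) qp).
  by apply: (bott_eqr oU sZ (s _) sL qp) => r rp; exact: cfield_linear.
have BB Z Z' : svf (dom A p) Z -> svf (dom A p) Z' ->
    bott Z' (bott Z (cfield A p (c *: u + v))) p =
    c *: bott Z' (bott Z (cfield A p u)) p + bott Z' (bott Z (cfield A p v)) p.
  move=> sZ sZ'; have sb x := bott_smooth oU sZ (s x).
  rewrite -(bott_lin c oU sZ' (sb u) (sb v) Up).
  apply: (bott_eqr oU sZ' (sb _) _ Up) => [|r rp]; last exact: B.
  by apply: (smooth_vfieldD oU _ (sb v)); exact: (smooth_vfieldZ oU (smooth_fun_cst A _ c) (sb u)).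
have e1 := BB _ _ sY sX; have e2 := BB _ _ sX sY.
have e3 := B _ _ (lie_smooth D_lc oU sX sY) Up.
rewrite /curvature; move: (lie A X Y) (Defs.bott A g V D) (cfield A p (c *: u + v))
  (cfield A p u) (cfield A p v) e1 e2 e3 => L bt Z Z1 Z2 e1 e2 e3.
rewrite e1 e2 e3; move: (bt X _ p) (bt X _ p) (bt Y _ p) (bt Y _ p) (bt L _ p) (bt L _ p).
by move=> a a' b b' d d'; apply/rowP => i; rewrite !mxE; ring.
Qed.


Lemma ricci_at_linear p x c u v :
  ricci_at A g V D p x (c *: u + v) = c * ricci_at A g V D p x u + ricci_at A g V D p x v.
Proof.
rewrite /ricci_at mulr_sumr -big_split /=; apply: eq_bigr => k _.
have := curvature_linear c u v (smooth_cfield A p (delta_mx 0 k)) (smooth_cfield A p x).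
move: (cfield A p (c *: u + v)) (cfield A p u) (cfield A p v) => Z Z1 Z2.
by move: (curvature _ _ _ _) => K ->; rewrite !mxE.
Qed.

Lemma ip_v_ric eta p b : ip_v g V p (ric_form A g V D eta p) b = 0.
Proof.
rewrite ip_vE ?gsym//; last by move=> *; exact: gpos.
rewrite pairing_covec => [|c u v]; last first.
  by rewrite mulmxDl -scalemxAl ricci_at_linear.
rewrite hpr_vpr; have := ricci_at_linear p (sharp p (eta p) *m hpr p) 1 0 0.
by rewrite scale1r addr0 mul1r; move: (ricci_at _ _ _ _ _ _ _) => r E; lra.
Qed.

(** A tensor acts on forms as it acts on the vectors that represent them. *)
Lemma pairing_tensor_act p (B : 'M[R]_(n + m)) a x :
  pairing (tensor_act g p B a) x = ip p (sharp p a *m B) x.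
Proof. by rewrite /pairing /tensor_act /cogadj trmxK /gip !mulmxA. Qed.

Lemma ip_v_J2 eta p b : ip_v g V p (J2_form A g V D eta p) b = 0.
Proof.
rewrite ip_vE ?gsym//; last by move=> *; exact: gpos.
by rewrite pairing_tensor_act (gip_orth (V := V)) ?J2_horizontal ?vpr_sub.
Qed.

Lemma ip_h_deltaT eta p b : ip_h g V p (deltaT_form A g V D eta p) b = 0.
Proof.
rewrite ip_hE ?gsym//; last by move=> *; exact: gpos.
rewrite pairing_tensor_act gipC ?gsym// (gip_orth (V := V)) ?hpr_sub//.
exact: deltaT_vertical.
Qed.

(** * The Bochner identity *)

Lemma bochner_identity eta p : smooth_form A setT eta ->
  2^-1 * hlaplacian A g V D (fun q => ipe q (eta q) (eta q)) p
  - ipe p (square A g V D eps eta p) (eta p)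
  = normsq_tensor g V eps p
      (fun i => nablaH A g V D eta p i - TepsH A g V D eps eta p i)
    + ip_h g V p (ric_form A g V D eta p) (eta p)
    - ip_v g V p (deltaT_form A g V D eta p) (eta p)
    + eps^-1 * ip_h g V p (J2_form A g V D eta p) (eta p).
Proof.
move=> se.
have E : 2^-1 * hlaplacian A g V D (fun q => ipe q (eta q) (eta q)) p =
    ipe p (rough_laplacian A g V D eps eta p) (eta p) + normsq_tensor g V eps p
      (fun i => nablaH A g V D eta p i - TepsH A g V D eps eta p i).
  rewrite /hlaplacian /rough_laplacian /normsq_tensor mulr_sumr ip_eps_suml -big_split.
  apply: eq_bigr => i _; have [U [oU Up sX Xh]] := hframe_spec p i.
  have seU : smooth_form A U eta by apply: (smooth_form_sub se).
  exact: bochner_direction oU sX Xh seU Up.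
rewrite {}E /square ip_epsDl ip_epsNl ip_epsDl ip_epsZl ip_epsDl ip_epsNl ip_epsZl.
have -> : ipe p (J2_form A g V D eta p) (eta p) = ip_h g V p (J2_form A g V D eta p) (eta p).
  by rewrite /ip_eps ip_v_J2 mulr0 addr0.
have -> : ipe p (deltaT_form A g V D eta p) (eta p) =
    eps * ip_v g V p (deltaT_form A g V D eta p) (eta p).
  by rewrite /ip_eps ip_h_deltaT add0r.
have -> : ipe p (ric_form A g V D eta p) (eta p) = ip_h g V p (ric_form A g V D eta p) (eta p).
  by rewrite /ip_eps ip_v_ric mulr0 addr0.
rewrite mulKf//.
move: (ipe _ _ _) (normsq_tensor _ _ _ _ _) (ip_h _ _ _ _ _) (ip_v _ _ _ _ _) (ip_h _ _ _ _ _).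
by move=> a b c e k; ring.
Qed.

End twisted.

End bott_calculus.

Theorem theorem4p7 (R : realType) (n m : nat) (M : topologicalType)
    (A : atlas R (n + m) M)
    (M_hausdorff : hausdorff_space M)
    (M_second_countable : @second_countable M)
    (M_connected : connected [set: M])
    (g : M -> 'M[R]_(n + m)) (g_metric : riemannian_metric A g)
    (V : M -> 'M[R]_(n + m)) (V_foliation : riemannian_foliation A g V n)
    (D : vfield R (n + m) M -> vfield R (n + m) M -> vfield R (n + m) M)
    (D_levi_civita : levi_civita A g D)
    (V_totally_geodesic : totally_geodesic_leaves A V D)
    (eps : R) (eps_gt0 : 0 < eps)
    (eta : oneform R (n + m) M) (eta_smooth : smooth_form A setT eta) :
  forall p : M,
    2^-1 * hlaplacian A g V D (fun q => ip_eps g V eps q (eta q) (eta q)) p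
    - ip_eps g V eps p (square A g V D eps eta p) (eta p)
    = normsq_tensor g V eps p
        (fun i => nablaH A g V D eta p i - TepsH A g V D eps eta p i)
      + ip_h g V p (ric_form A g V D eta p) (eta p)
      - ip_v g V p (deltaT_form A g V D eta p) (eta p)
      + eps^-1 * ip_h g V p (J2_form A g V D eta p) (eta p).
Proof.
move=> p; exact: (bochner_identity g_metric V_foliation D_levi_civita
  V_totally_geodesic (lt0r_neq0 eps_gt0) p eta_smooth).
Qed.
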